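(* Let $X\to Z$ be a split family of tropical semiabelian varieties. Every birational equivalence class of generalized partial tropical compactifications of $X\to Z$ contains a unique minimal element. For any partial tropical compactification $Y\to X$, the minimal element in the birational equivalence class of $Y$ is $M_Y$.
   Context: **Cones.** $\mathbf{RPC}$: objects $(\sigma,N_\sigma)$, $N_\sigma$ a lattice and $\sigma\subseteq N_\sigma\otimes\mathbb R$ a full-dimensional strongly convex rational polyhedral cone; morphisms are homomorphisms of lattices mapping cone into cone. $M_\sigma$ is dual to $N_\sigma$. Stacks over $\mathbf{RPC}$ are categories fibred in groupoids (chaotic topology). A cone stack is a category $C$ fibred in groupoids over the category of cones with face morphisms, regarded as the stack over $\mathbf{RPC}$ whose objects over $\sigma$ are pairs of an object $c\in C$ over a cone $\sigma_c$ and a morphism $\sigma\to\sigma_c$ meeting the interior of $\sigma_c$. It is finite if it has finitely many objects and morphisms up to isomorphism. A morphism $Y\to X$ of stacks over $\mathbf{RPC}$ is representable by finite cone stacks if $Y\times_X\sigma$ is a finite cone stack for every $\sigma\to X$ from a cone. It is a subdivision if for each $\sigma\to X$ from a cone, $Y\times_X\sigma\to\sigma$ is a subdivision (a finite fan with support $\sigma$, each cone $\tau$ with lattice $N_\sigma\cap\operatorname{span}\tau$). **Tropical semiabelian varieties.** $T_N^{\mathrm{trop}}$ is $\sigma\mapsto\operatorname{Hom}(N_\sigma,N)$ and $\mathbb G_{m,\mathrm{trop}}=T_{\mathbb Z}^{\mathrm{trop}}$. A family of tropical tori is a group object $X\to Z$ with $X\times_Z\sigma\cong\sigma\times T_N^{\mathrm{trop}}$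 for all $\sigma\to Z$. For a cone $\sigma_0$, a lattice $M$ and a symmetric bilinear $Q:M\times M\to M_{\sigma_0}$ with $Q(m,m)\in\sigma_0^\vee\setminus\{0\}$ for $m\ne0$, let $\operatorname{Hom}(\underline M,\mathbb G_{m,\mathrm{trop}})^{(M)}$ be the sheaf on $\mathbf{RPC}/\sigma_0$ assigning to $\tau$ the $\phi\in\operatorname{Hom}(M,M_\tau)$ such that for each $m\in M$ there are $m_1,m_2\in M$ with $\phi(m)-Q_\tau(m_1,m)\in\tau^\vee$ and $Q_\tau(m_2,m)-\phi(m)\in\tau^\vee$ ($Q_\tau$ = composite of $Q$ with $M_{\sigma_0}\to M_\tau$). The quotient by the image of $m\mapsto Q(m,\cdot)$ is a family of tropical abelian varieties over $\sigma_0$; over a general base a family is a group object whose base change to every cone is of this form. A split family of tropical semiabelian varieties is a product of a family of tropical abelian varieties and a family of tropical tori. **Tropical compactifications.** A partial tropical compactification of $X\to Z$ is a monomorphism $Y\to X$ representable by finite cone stacks such that the zero section $Z\to X$ lifts to a section $Z\to Y$. A generalized partial tropical compactification is a monomorphism $Y\to X$ for which there is a subdivision $Y'\to Y$ such that $Y'\to X$ is a partial tropical compactification. Morphisms are morphisms over $X$. $Y_1,Y_2$ are birationally equivalent if there is a generalized partial tropical compactification $Y_3$ with morphisms $Y_3\to Y_1$, $Y_3\to Y_2$ that are subdivisions. $Y\to X$ is minimal if for every morphism $Y_1\to X$ from a stack $Y_1$ over $\mathbf{RPC}$ and every subdivision $Y_2\to Y_1$, every morphism $Y_2\to Y$ over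 $X$ descends uniquely to a morphism $Y_1\to Y$ over $X$. $M_Y$ is the stack whose morphisms $\sigma\to M_Y$ are the morphisms $\sigma\to X$ such that there exist a subdivision $\Sigma\to\sigma$ and a map $\Sigma\to Y$ lifting $\Sigma\to\sigma\to X$. *)

(* Defs.v *)
From HB Require Import structures.
From mathcomp Require Import all_boot all_order all_algebra.
From mathcomp Require Import all_classical all_reals topology normedtype.

Set Implicit Arguments.
Unset Strict Implicit.
Unset Printing Implicit Defensive.

Import Order.TTheory GRing.Theory Num.Theory.
Import numFieldNormedType.Exports.
Local Open Scope classical_set_scope.
Local Open Scope ring_scope.

Lemma sval_inj (T : Type) (P : T -> Prop) (a b : {x | P x}) :
  sval a = sval b -> a = b.
Proof.
case: a b => [a aP] [b bP] /= e; subst.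
by congr exist; apply: Prop_irrelevance.
Qed.

Record category := Category {
  cob :> Type;
  hom : cob -> cob -> Type;
  idc : forall a, hom a a;
  (* diagrammatic order: first the left argument *)
  seqc : forall a b c, hom a b -> hom b c -> hom a c;
  seqc_idl : forall a b (f : hom a b), f = seqc (idc a) f;
  seqc_idr : forall a b (f : hom a b), f = seqc f (idc b);
  seqcA : forall a b c d (f : hom a b) (g : hom b c) (h : hom c d),
    seqc f (seqc g h) = seqc (seqc f g) h }.

Arguments idc {_} _.

(* A category over B, presented by its objects over each object of B and its
   arrows over each arrow of B.  Composition takes the composite in B as an
   argument, with a proof that it is the composite, so that the laws need no
   transport. *)
Record catover (B : category) := CatOver {
  ob :> B -> Type;
  arr : forall (s t : B), hom s t -> ob s -> ob t -> Type;
  ida : forall (s : B) (x : ob s), arr (idc s) x x;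
  cmp : forall (s t u : B) (f : hom s t) (g : hom t u) (h : hom s u),
    h = seqc f g ->
    forall x y z, arr f x y -> arr g y z -> arr h x z;
  cmp_idl : forall (s t : B) (f : hom s t) (e : f = seqc (idc s) f) x y
    (a : arr f x y), cmp e (ida x) a = a;
  cmp_idr : forall (s t : B) (f : hom s t) (e : f = seqc f (idc t)) x y
    (a : arr f x y), cmp e a (ida y) = a;
  cmpA : forall (s t u v : B) (f : hom s t) (g : hom t u) (k : hom u v)
    (fg : hom s u) (gk : hom t v) (h : hom s v)
    (e1 : fg = seqc f g) (e2 : h = seqc fg k)
    (e3 : gk = seqc g k) (e4 : h = seqc f gk)
    x y z w (a : arr f x y) (b : arr g y z) (c : arr k z w),
    cmp e4 a (cmp e3 b c) = cmp e2 (cmp e1 a b) c }.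

Arguments arr {B _ s t} f x y.
Arguments ida {B _ s} x.
Arguments cmp {B _ s t u f g h} e {x y z} a b.

Section CategoriesOver.
Context {B : category}.

Lemma cmp_existT (C : catover B) (s t u : B) (f : hom s t) (g : hom t u)
    (h : hom s u) (e : h = seqc f g) (x : C s) (y : C t) (z : C u)
    (a : arr f x y) (b : arr g y z) :
  existT (fun k => arr k x z) (seqc f g) (cmp erefl a b) =
  existT (fun k => arr k x z) h (cmp e a b).
Proof. by subst h. Qed.

Definition fibred_in_groupoids (C : catover B) : Prop :=
  (forall (s t : B) (f : hom s t) (y : C t),
     exists x : C s, inhabited (arr f x y)) /\
  (forall (s t u : B) (f : hom s t) (g : hom t u) (h : hom s u)
     (e : h = seqc f g) (x : C s) (y : C t) (z : C u)
     (b : arr g y z) (c : arr h x z),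
     exists! a : arr f x y, cmp e a b = c).

Definition invertible (C : catover B) (s : B) (x y : C s)
    (a : arr (idc s) x y) : Prop :=
  exists b : arr (idc s) y x,
    cmp (seqc_idl (idc s)) a b = ida x /\ cmp (seqc_idl (idc s)) b a = ida y.

Record functor (C D : catover B) := Functor {
  fo :> forall s : B, C s -> D s;
  fa : forall (s t : B) (f : hom s t) (x : C s) (y : C t),
    arr f x y -> arr f (fo x) (fo y);
  fa_id : forall (s : B) (x : C s), fa (ida x) = ida (fo x);
  fa_cmp : forall (s t u : B) (f : hom s t) (g : hom t u) (h : hom s u)
    (e : h = seqc f g) (x : C s) (y : C t) (z : C u)
    (a : arr f x y) (b : arr g y z),
    fa (cmp e a b) = cmp e (fa a) (fa b) }.

Arguments fa {C D} F {s t f x y} : rename.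

Definition fid (C : catover B) : functor C C.
Proof. by apply: (@Functor C C (fun s x => x) (fun s t f x y a => a)). Defined.

Definition fcomp (C D E : catover B) (G : functor D E) (F : functor C D) :
  functor C E.
Proof.
apply: (@Functor C E (fun s x => G s (F s x)) (fun s t f x y a => fa G (fa F a))).
- by move=> s x; rewrite !fa_id.
- by move=> s t u f g h e x y z a b; rewrite !fa_cmp.
Defined.

(* The components lie over identities of the base. *)
Record nat_iso (C D : catover B) (F G : functor C D) := NatIso {
  ni :> forall (s : B) (x : C s), arr (idc s) (F s x) (G s x);
  ni_nat : forall (s t : B) (f : hom s t) (x : C s) (y : C t) (a : arr f x y),
    cmp (seqc_idl f) (ni x) (fa G a) = cmp (seqc_idr f) (fa F a) (ni y);
  ni_inv : forall (s : B) (x : C s), invertible (ni x) }.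

Definition isomorphic (C D : catover B) (F G : functor C D) : Prop :=
  inhabited (nat_iso F G).

Definition equivalence (C D : catover B) (F : functor C D) : Prop :=
  exists G : functor D C,
    isomorphic (fcomp G F) (fid C) /\ isomorphic (fcomp F G) (fid D).

(* Fully faithful on the total categories; for categories fibred in groupoids
   this is the 2-categorical notion of monomorphism. *)
Definition monomorphism (C D : catover B) (F : functor C D) : Prop :=
  forall (s t : B) (f : hom s t) (x : C s) (y : C t)
    (b : arr f (F s x) (F t y)), exists! a : arr f x y, fa F a = b.

Definition rep (s : B) : catover B.
Proof.
apply: (@CatOver B (fun t => hom t s) (fun t u f x y => x = seqc f y)).
- by move=> t x; apply: seqc_idl.
- by move=> t u v f g h -> x y z -> ->; apply: seqcA.
all: by move=> *; apply: Prop_irrelevance.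
Defined.

Section FibreProduct.
Variables (C D E : catover B) (F : functor C E) (G : functor D E).

Record fp_ob (s : B) := FpOb {
  fp_l : C s;
  fp_r : D s;
  fp_i : arr (idc s) (F s fp_l) (G s fp_r);
  fp_iP : invertible fp_i }.

Record fp_mor (s t : B) (f : hom s t) (p : fp_ob s) (q : fp_ob t) := FpMor {
  fp_ml : arr f (fp_l p) (fp_l q);
  fp_mr : arr f (fp_r p) (fp_r q);
  fp_mP : cmp (seqc_idl f) (fp_i p) (fa G fp_mr) =
          cmp (seqc_idr f) (fa F fp_ml) (fp_i q) }.

Lemma fp_mor_eq (s t : B) (f : hom s t) (p : fp_ob s) (q : fp_ob t)
    (a b : fp_mor f p q) :
  fp_ml a = fp_ml b -> fp_mr a = fp_mr b -> a = b.
Proof.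
case: a b => [al ar aP] [bl br bP] /= e1 e2; subst.
by congr FpMor; apply: Prop_irrelevance.
Qed.

Definition fp_id (s : B) (p : fp_ob s) : fp_mor (idc s) p p.
Proof.
exists (ida (fp_l p)) (ida (fp_r p)).
by rewrite !fa_id cmp_idl cmp_idr.
Defined.

Definition fp_cmp (s t u : B) (f : hom s t) (g : hom t u) (h : hom s u)
    (e : h = seqc f g) (p : fp_ob s) (q : fp_ob t) (r : fp_ob u)
    (a : fp_mor f p q) (b : fp_mor g q r) : fp_mor h p r.
Proof.
exists (cmp e (fp_ml a) (fp_ml b)) (cmp e (fp_mr a) (fp_mr b)).
rewrite !fa_cmp (cmpA (seqc_idl f) e e) fp_mP.
rewrite -(cmpA (seqc_idr f) e (seqc_idl g) e) fp_mP.
by rewrite (cmpA e (seqc_idr h) (seqc_idr g) e).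
Defined.

Definition fibre_product : catover B.
Proof.
apply: (@CatOver B fp_ob fp_mor fp_id fp_cmp).
- by move=> *; apply: fp_mor_eq; rewrite /= cmp_idl.
- by move=> *; apply: fp_mor_eq; rewrite /= cmp_idr.
- by move=> *; apply: fp_mor_eq; rewrite /=; apply: cmpA.
Defined.

Definition fp_proj1 : functor fibre_product C.
Proof.
by apply: (@Functor fibre_product C (fun s p => fp_l p)
             (fun s t f p q a => fp_ml a)).
Defined.

Definition fp_proj2 : functor fibre_product D.
Proof.
by apply: (@Functor fibre_product D (fun s p => fp_r p)
             (fun s t f p q a => fp_mr a)).
Defined.

End FibreProduct.

Section FullSub.
Variables (C : catover B) (P : forall s, C s -> Prop).

Definition full_sub : catover B.
Proof.
apply: (@CatOver B (fun s => {x : C s | P x})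
  (fun s t f x y => arr f (sval x) (sval y))
  (fun s x => ida (sval x))
  (fun s t u f g h e x y z a b => cmp e a b)).
- by move=> *; apply: cmp_idl.
- by move=> *; apply: cmp_idr.
- by move=> *; apply: cmpA.
Defined.

Definition full_sub_incl : functor full_sub C.
Proof.
by apply: (@Functor full_sub C (fun s x => sval x) (fun s t f x y a => a)).
Defined.

End FullSub.

Record over_mor (X C D : catover B) (F : functor C X) (G : functor D X) :=
  OverMor {
    om :> functor C D;
    om_iso : nat_iso (fcomp G om) F }.

Definition whisker (C D E : catover B) (F G : functor D E) (n : nat_iso F G)
    (H : functor C D) : nat_iso (fcomp F H) (fcomp G H).
Proof.
apply: (@NatIso _ _ (fcomp F H) (fcomp G H) (fun s x => n s (H s x))).
- by move=> s t f x y a /=; apply: (ni_nat n).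
- by move=> s x; apply: (ni_inv n).
Defined.

Definition over_precomp (X C' C D : catover B) (F : functor C X)
    (G : functor D X) (K : over_mor F G) (S : functor C' C) :
  over_mor (fcomp F S) G.
Proof.
exists (fcomp K S); have w := whisker (om_iso K) S.
exact: (@NatIso _ _ (fcomp G (fcomp K S)) (fcomp F S) w (@ni_nat _ _ _ _ w)
          (@ni_inv _ _ _ _ w)).
Defined.

Definition over_isomorphic (X C D : catover B) (F : functor C X)
    (G : functor D X) (K L : over_mor F G) : Prop :=
  exists d : nat_iso K L, forall (s : B) (x : C s),
    cmp (seqc_idl (idc s)) (fa G (d s x)) (om_iso L s x) = om_iso K s x.

(* A presheaf of abelian groups on the total category of Z. *)
Record presheaf (Z : catover B) := Presheaf {
  sec :> forall s : B, Z s -> zmodType;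
  res : forall (s t : B) (f : hom s t) (x : Z s) (y : Z t),
    arr f x y -> sec y -> sec x;
  res_add : forall (s t : B) (f : hom s t) (x : Z s) (y : Z t)
    (a : arr f x y) (u v : sec y), res a (u + v) = res a u + res a v;
  res_id : forall (s : B) (x : Z s) (u : sec x), res (ida x) u = u;
  res_cmp : forall (s t u : B) (f : hom s t) (g : hom t u) (h : hom s u)
    (e : h = seqc f g) (x : Z s) (y : Z t) (z : Z u)
    (a : arr f x y) (b : arr g y z) (v : sec z),
    res (cmp e a b) v = res a (res b v) }.

Arguments res {Z} G {s t f x y} a u : rename.

Section Elements.
Variables (Z : catover B).

Lemma res0 (G : presheaf Z) (s t : B) (f : hom s t) (x : Z s) (y : Z t)
  (a : arr f x y) : res G a 0 = 0.
Proof. by apply: (addrI (res G a 0)); rewrite -res_add !addr0. Qed.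

Definition elements (G : presheaf Z) : catover B.
Proof.
apply: (@CatOver B (fun s => {x : Z s & G s x})
  (fun s t f p q => {a : arr f (projT1 p) (projT1 q) |
                       res G a (projT2 q) = projT2 p})
  (fun s p => exist _ (ida (projT1 p)) (res_id (projT2 p)))
  (fun s t u f g h e p q r a b => exist _ (cmp e (sval a) (sval b))
     (etrans (res_cmp e (sval a) (sval b) (projT2 r))
       (etrans (congr1 (res G (sval a)) (svalP b)) (svalP a))))).
- by move=> *; apply: sval_inj; rewrite /= cmp_idl.
- by move=> *; apply: sval_inj; rewrite /= cmp_idr.
- by move=> *; apply: sval_inj; apply: cmpA.
Defined.

Definition elements_proj (G : presheaf Z) : functor (elements G) Z.
Proof.
by apply: (@Functor (elements G) Z (fun s p => projT1 p)
             (fun s t f p q a => sval a)).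
Defined.

Definition zero_elements (G : presheaf Z) : functor Z (elements G).
Proof.
apply: (@Functor Z (elements G) (fun s x => existT (fun x => G s x) x 0)
  (fun s t f x y a => exist _ a (res0 G a))).
- by move=> s x; apply: sval_inj.
- by move=> *; apply: sval_inj.
Defined.

Definition presheaf_prod (G H : presheaf Z) : presheaf Z.
Proof.
apply: (@Presheaf Z (fun s x => (G s x * H s x)%type : zmodType)
  (fun s t f x y a u => (res G a u.1, res H a u.2))).
- by move=> s t f x y a u v; rewrite !res_add.
- by move=> s x [u v]; rewrite !res_id.
- by move=> *; rewrite !res_cmp.
Defined.

End Elements.
End CategoriesOver.

Arguments fa {B C D} F {s t f x y} : rename.
Arguments res {B Z} G {s t f x y} a u : rename.

Section Cones.
Context {R : realType}.

(* Lattices are taken in the form Z^n, written as rows; their duals are written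
   as columns, and a homomorphism is a matrix acting on the right. *)
Definition realmx (m n : nat) (A : 'M[int]_(m, n)) : 'M[R]_(m, n) :=
  map_mx (fun z : int => z%:~R) A.

Definition cone_span (n : nat) (gens : seq 'rV[int]_n) : set 'rV[R]_n :=
  [set x | exists c : 'I_(size gens) -> R,
     (forall i, 0 <= c i) /\ x = \sum_i c i *: realmx (nth 0 gens i)].

Definition rational_polyhedral (n : nat) (S : set 'rV[R]_n) : Prop :=
  exists gens : seq 'rV[int]_n, S = cone_span gens.

Record cone := Cone {
  rk : nat;
  cset : set 'rV[R]_rk;
  cone_polyhedral : rational_polyhedral cset;
  cone_strongly_convex : forall x, cset x -> cset (- x) -> x = 0;
  cone_full : forall v, exists x y, cset x /\ cset y /\ v = x - y }.

Arguments cset : clear implicits.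

Record cone_hom (s t : cone) := ConeHom {
  hmx :> 'M[int]_(rk s, rk t);
  hmxP : forall x, cset s x -> cset t (x *m realmx hmx) }.

Lemma realmxM m n p (A : 'M[int]_(m, n)) (B : 'M[int]_(n, p)) :
  realmx (A *m B) = realmx A *m realmx B.
Proof. exact: (map_mxM (intmul (1 : R))). Qed.

Lemma realmx1 n : realmx (1%:M : 'M[int]_n) = 1%:M.
Proof. exact: (map_mx1 (intmul (1 : R))). Qed.

Lemma cone_hom_eq s t (f g : cone_hom s t) : f = g :> 'M_(_, _) -> f = g.
Proof.
case: f g => [a aP] [b bP] /= e; subst.
by congr ConeHom; apply: Prop_irrelevance.
Qed.

Definition cone_id (s : cone) : cone_hom s s.
Proof. by exists 1%:M => x; rewrite realmx1 mulmx1. Defined.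

Definition cone_comp (s t u : cone) (f : cone_hom s t) (g : cone_hom t u) :
  cone_hom s u.
Proof.
by exists (f *m g) => x sx; rewrite realmxM mulmxA; do 2 apply: hmxP.
Defined.

Definition RPC : category.
Proof.
apply: (@Category cone cone_hom cone_id cone_comp).
- by move=> s t f; apply: cone_hom_eq; rewrite /= mul1mx.
- by move=> s t f; apply: cone_hom_eq; rewrite /= mulmx1.
- by move=> s t u v f g h; apply: cone_hom_eq; rewrite /= mulmxA.
Defined.

Definition face_of (n : nat) (F S : set 'rV[R]_n) : Prop :=
  exists u : 'cV[R]_n,
    (forall x, S x -> 0 <= (x *m u) 0 0) /\
    F = [set x | S x /\ x *m u = 0].

Definition himg (s t : cone) (f : cone_hom s t) : set 'rV[R]_(rk t) :=
  [set x *m realmx f | x in cset s].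

(* f identifies N_s with the intersection of N_t and the span of the image of
   s, which is the image of f over R since s is full-dimensional. *)
Definition lattice_embedding (s t : cone) (f : cone_hom s t) : Prop :=
  injective (fun v : 'rV[int]_(rk s) => v *m f) /\
  forall w : 'rV[int]_(rk t),
    (exists v : 'rV[R]_(rk s), v *m realmx f = realmx w) ->
    exists v : 'rV[int]_(rk s), v *m f = w.

Definition face_morphism (s t : cone) (f : cone_hom s t) : Prop :=
  lattice_embedding f /\ face_of (himg f) (cset t).

Lemma face_morphism_id s : face_morphism (cone_id s).
Proof.
split; first split.
- by move=> v w /=; rewrite !mulmx1.
- by move=> w _; exists w; rewrite mulmx1.
exists 0; split=> [x _|]; first by rewrite mulmx0 mxE.
apply/seteqP; split=> [y [x sx <-]|x [sx _]].
  by rewrite /= realmx1 mulmx1 mulmx0.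
by exists x => //; rewrite /= realmx1 mulmx1.
Qed.

(* An integral matrix with trivial left kernel has one over R too. *)
Lemma row_free_realmx m n (A : 'M[int]_(m, n)) :
  injective (fun v : 'rV[int]_m => v *m A) -> row_free (realmx A).
Proof.
move=> injA; pose Q : 'M[rat]_(m, n) := map_mx intr A.
have -> : realmx A = map_mx ratr Q.
  by apply/matrixP => i j; rewrite !mxE ratr_int.
rewrite row_free_map -kermx_eq0; apply/eqP/row_matrixP => i.
rewrite row0; have := congr1 (row i) (mulmx_ker Q); rewrite row_mul row0.
move: (row i _) => v vQ.
pose d : int := \prod_j denq (v 0 j).
have d0 : d != 0 by apply/prodf_neq0 => j _; apply: denq_neq0.
have [w wE] : exists w : 'rV[int]_m, map_mx intr w = d%:~R *: v.
  exists (\row_j (numq (v 0 j) * \prod_(k | k != j) denq (v 0 k))).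
  apply/rowP => j; rewrite !mxE.
  have -> : d = denq (v 0 j) * \prod_(k | k != j) denq (v 0 k).
    by rewrite /d (bigD1 j).
  by rewrite !intrM numqE [RHS]mulrC mulrA.
have w0 : w = 0.
  apply: injA; rewrite mul0mx.
  have : map_mx intr (w *m A) = 0 :> 'M[rat]_(1, n).
    by rewrite map_mxM wE -scalemxAl vQ scaler0.
  move=> /matrixP wA; apply/matrixP => k l; apply: (@intr_inj rat).
  by move: (wA k l); rewrite [LHS]mxE => ->; rewrite !mxE.
move: wE; rewrite w0 map_mx0 => /esym/eqP.
by rewrite scaler_eq0 intr_eq0 (negPf d0) => /eqP.
Qed.

Lemma cone_span_gen n (gens : seq 'rV[int]_n) (i : 'I_(size gens)) :
  cone_span gens (realmx (nth 0 gens i)).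
Proof.
exists (fun j => (j == i)%:R); split=> [j|]; first exact: ler0n.
rewrite (bigD1 i) //= eqxx scale1r big1 ?addr0 // => j /negPf ->.
by rewrite scale0r.
Qed.

Lemma face_of_trans n (F G S : set 'rV[R]_n) :
  rational_polyhedral S -> face_of F G -> face_of G S -> face_of F S.
Proof.
move=> [gens SE] [w [w_ge0 FE]] [u [u_ge0 GE]].
pose g (i : 'I_(size gens)) : 'rV[R]_n := realmx (nth 0 gens i).
have Sg i : S (g i) by rewrite SE; apply: cone_span_gen.
pose a i := (g i *m u) 0 0; pose b i := (g i *m w) 0 0.
have a0 i : 0 <= a i by apply: u_ge0.
have mx11 (M : 'M[R]_1) : (M == 0) = (M 0 0 == 0).
  by apply/eqP/eqP => [->|M0]; [rewrite mxE | apply/rowP => j; rewrite ord1 mxE].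
have bG i : a i = 0 -> 0 <= b i.
  move=> ai; apply: w_ge0; rewrite GE; split=> //.
  by apply/eqP; rewrite mx11; apply/eqP.
pose p := 1 + \sum_i `|b i| / a i.
have p_ge1 : 1 <= p.
  by rewrite lerDl sumr_ge0 // => i _; rewrite mulr_ge0 // invr_ge0.
have p_gt i : a i != 0 -> 0 < b i + p * a i.
  move=> ai; have ai_gt0 : 0 < a i by rewrite lt0r ai a0.
  have : `|b i| / a i <= p - 1.
    rewrite addrAC subrr add0r (bigD1 i) //= lerDl sumr_ge0 // => j _.
    by rewrite mulr_ge0 // invr_ge0.
  rewrite ler_pdivrMr // mulrBl mul1r => h.
  have h2 : - b i <= `|b i| by rewrite -normrN ler_norm.
  rewrite -ltrBlDl sub0r; apply: le_lt_trans h2 (le_lt_trans h _).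
  by rewrite ltrBlDr ltrDl.
have U_ge0 i : 0 <= b i + p * a i.
  have [ai|ai] := eqVneq (a i) 0; first by rewrite ai mulr0 addr0 bG.
  exact: ltW (p_gt i ai).
have UE (c : 'I_(size gens) -> R) (h : 'cV[R]_n) :
    ((\sum_i c i *: g i) *m h) 0 0 = \sum_i c i * (g i *m h) 0 0.
  rewrite mulmx_suml summxE; apply: eq_bigr => i _.
  by rewrite -scalemxAl mxE.
have Ug i : (g i *m (w + p *: u)) 0 0 = b i + p * a i.
  by rewrite mulmxDr -scalemxAr mxE [X in _ + X]mxE.
exists (w + p *: u); split=> [x|].
  rewrite SE => -[c [c0 ->]]; rewrite UE sumr_ge0 // => i _.
  by rewrite Ug; apply: mulr_ge0 (c0 i) (U_ge0 i).
rewrite FE GE; apply/seteqP; split=> x /=.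
  by move=> [[Sx xu] xw]; split=> //; rewrite mulmxDr -scalemxAr xu xw scaler0 addr0.
move=> [Sx xU]; have : S x by []; rewrite {1}SE => -[c [c0 xE]].
have cU i : c i * (b i + p * a i) = 0.
  have /eqP : \sum_j c j * (b j + p * a j) = 0.
    have -> : \sum_j c j * (b j + p * a j) = (x *m (w + p *: u)) 0 0.
      by rewrite xE UE; apply: eq_bigr => j _; rewrite Ug.
    by rewrite xU mxE.
  rewrite psumr_eq0 => [/allP/(_ i (mem_index_enum i))/eqP //|j _].
  by apply: mulr_ge0 (c0 j) (U_ge0 j).
have xu : x *m u = 0.
  apply/eqP; rewrite mx11 xE UE big1 // => i _.
  have [ai|ai] := eqVneq (a i) 0; first by rewrite -/(a i) ai mulr0.
  have /eqP := cU i; rewrite mulf_eq0 (gt_eqF (p_gt i ai)) orbF => /eqP ->.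
  by rewrite mul0r.
by split=> //; move: xU; rewrite mulmxDr -scalemxAr xu scaler0 addr0.
Qed.

Lemma face_morphism_comp s t u (f : cone_hom s t) (g : cone_hom t u) :
  face_morphism f -> face_morphism g -> face_morphism (cone_comp f g).
Proof.
move=> [[injf satf] ff] [[injg satg] fg]; split; first split.
- by move=> v w /=; rewrite !mulmxA => /injg/injf.
- move=> w [v]; rewrite /= realmxM mulmxA => vE.
  have [v' v'E] : exists v', v' *m g = w by apply: satg; exists (v *m realmx f).
  have [v'' v''E] : exists v'', v'' *m f = v'.
    apply: satf; exists v; apply: (row_free_inj (row_free_realmx injg)).
    by rewrite vE -v'E realmxM.
  by exists v''; rewrite mulmxA v''E.
apply: face_of_trans (cone_polyhedral u) _ fg.
case: ff => w [w0 fE].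
have [P gP] := row_freeP (row_free_realmx injg).
exists (P *m w); split=> [x [y ty <-]|].
  by rewrite -mulmxA (mulmxA _ P) gP mul1mx w0.
apply/seteqP; split=> [x [y sy <-]|x [[y ty <-]]] /=.
  have : himg f (y *m realmx f) by exists y.
  rewrite fE => -[ty yw]; rewrite realmxM mulmxA; split.
    by exists (y *m realmx f).
  by rewrite -!mulmxA (mulmxA _ P) gP mul1mx mulmxA.
rewrite -mulmxA (mulmxA _ P) gP mul1mx => yw.
have : himg f y by rewrite fE.
by case=> z sz <-; exists z => //; rewrite realmxM mulmxA.
Qed.

Record face_hom (s t : cone) := FaceHom {
  fhom :> cone_hom s t;
  fhomP : face_morphism fhom }.

Lemma face_hom_eq s t (f g : face_hom s t) : f = g :> cone_hom s t -> f = g.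
Proof.
case: f g => [a aP] [b bP] /= e; subst.
by congr FaceHom; apply: Prop_irrelevance.
Qed.

Definition face_id (s : cone) : face_hom s s := FaceHom (face_morphism_id s).

Definition face_comp (s t u : cone) (f : face_hom s t) (g : face_hom t u) :
  face_hom s u := FaceHom (face_morphism_comp (fhomP f) (fhomP g)).

Definition RPCf : category.
Proof.
apply: (@Category cone face_hom face_id face_comp).
- by move=> s t f; apply/face_hom_eq/(@seqc_idl RPC).
- by move=> s t f; apply/face_hom_eq/(@seqc_idr RPC).
- by move=> s t u v f g h; apply/face_hom_eq/(@seqcA RPC).
Defined.

Definition meets_interior (s t : cone) (h : cone_hom s t) : Prop :=
  exists x, cset s x /\ interior (cset t) (x *m realmx h).

Section StackOf.
Variable C : catover RPCf.

(* The stack over RPC of a category C over the category of cones with face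
   morphisms: an object over s is an object of C over some cone, with a morphism
   from s to that cone meeting its interior. *)
Record so_ob (s : cone) := SoOb {
  so_cone : cone;
  so_c : C so_cone;
  so_h : cone_hom s so_cone;
  so_hP : meets_interior so_h }.

Record so_arr (s t : cone) (f : cone_hom s t) (p : so_ob s) (q : so_ob t) :=
  SoArr {
    so_k : face_hom (so_cone p) (so_cone q);
    so_m : @arr RPCf C _ _ so_k (so_c p) (so_c q);
    so_e : cone_comp (so_h p) so_k = cone_comp f (so_h q) }.

Lemma so_arr_eq (s t : cone) (f : cone_hom s t) (p : so_ob s) (q : so_ob t)
    (a b : so_arr f p q) :
  existT (fun k : face_hom _ _ => @arr RPCf C _ _ k (so_c p) (so_c q))
    (so_k a) (so_m a) = existT _ (so_k b) (so_m b) -> a = b.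
Proof.
pose T := {k : face_hom (so_cone p) (so_cone q) &
             @arr RPCf C _ _ k (so_c p) (so_c q)}.
have mk_eq (u v : T) e e' : u = v ->
    @SoArr s t f p q (projT1 u) (projT2 u) e =
    @SoArr s t f p q (projT1 v) (projT2 v) e'.
  by move=> uv; subst v; rewrite (Prop_irrelevance e e').
case: a b => [k m e] [k' m' e'] /= E.
exact: (mk_eq (existT _ k m) (existT _ k' m') e e' E).
Qed.

Definition so_id (s : cone) (p : so_ob s) : so_arr (cone_id s) p p.
Proof.
exists (face_id _); first exact: (@ida RPCf C).
by apply: etrans (esym (@seqc_idr RPC _ _ _)) (@seqc_idl RPC _ _ _).
Defined.

Definition so_cmp (s t u : cone) (f : cone_hom s t) (g : cone_hom t u)
    (h : cone_hom s u) (e : h = cone_comp f g)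
    (p : so_ob s) (q : so_ob t) (r : so_ob u)
    (a : so_arr f p q) (b : so_arr g q r) : so_arr h p r.
Proof.
exists (face_comp (so_k a) (so_k b)).
  exact: (@cmp RPCf C _ _ _ _ _ _ erefl _ _ _ (so_m a) (so_m b)).
rewrite e; apply: etrans (@seqcA RPC _ _ _ _ _ _ _) _.
rewrite /= so_e; apply: etrans (esym (@seqcA RPC _ _ _ _ _ _ _)) _.
by rewrite /= so_e; apply: (@seqcA RPC).
Defined.

Definition stack_of : catover RPC.
Proof.
apply: (@CatOver RPC so_ob so_arr so_id so_cmp).
- move=> s t f e p q a; apply: so_arr_eq.
  apply: etrans (@cmp_existT RPCf C _ _ _ _ _ _ (@seqc_idl RPCf _ _ (so_k a))
                   _ _ _ _ _) _.
  by rewrite (@cmp_idl RPCf).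
- move=> s t f e p q a; apply: so_arr_eq.
  apply: etrans (@cmp_existT RPCf C _ _ _ _ _ _ (@seqc_idr RPCf _ _ (so_k a))
                   _ _ _ _ _) _.
  by rewrite (@cmp_idr RPCf).
- move=> s t u v f g k fg gk h e1 e2 e3 e4 p q r w a b c; apply: so_arr_eq.
  apply: etrans (@cmp_existT RPCf C _ _ _ _ _ _
    (esym (@seqcA RPCf _ _ _ _ (so_k a) (so_k b) (so_k c))) _ _ _ _ _) _.
  by rewrite (@cmpA RPCf C _ _ _ _ _ _ _ _ _ _ erefl erefl erefl _).
Defined.
End StackOf.

Definition iso_over_RPCf (C : catover RPCf) (s t : RPCf) (x : C s) (y : C t) :
  Prop :=
  exists (f : hom s t) (g : hom t s) (a : arr f x y) (b : arr g y x)
    (e : idc s = seqc f g) (e' : idc t = seqc g f),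
    cmp e a b = ida x /\ cmp e' b a = ida y.

(* Finitely many objects and morphisms up to isomorphism means equivalent to a
   category with finitely many objects and finitely many morphisms. *)
Definition finite_cone_stack (C : catover RPCf) : Prop :=
  fibred_in_groupoids C /\
  (exists D : set {s : RPCf & C s}, finite_set D /\
     forall (s : RPCf) (x : C s), exists d : {s : RPCf & C s},
       D d /\ iso_over_RPCf x (projT2 d)) /\
  (forall (s t : RPCf) (x : C s) (y : C t),
     finite_set [set: {f : hom s t & arr f x y}]).

Definition representable_by_finite_cone_stacks (Y X : catover RPC)
    (F : functor Y X) : Prop :=
  forall (s : RPC) (g : functor (rep s) X),
    exists C : catover RPCf, finite_cone_stack C /\
      exists E : functor (stack_of C) (fibre_product F g), equivalence E.

Definition fan_subdividing (s : cone) (S : set (set 'rV[R]_(rk s))) : Prop :=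
  [/\ finite_set S,
      forall T, S T -> rational_polyhedral T,
      forall T T', S T -> face_of T' T -> S T',
      forall T T', S T -> S T' -> face_of (T `&` T') T
    & \bigcup_(T in S) T = cset s].

(* The cones of the fan, each with the lattice N_s \cap span: an object over r
   identifies r, with its lattice, with such a cone. *)
Definition fan_cone_stack (s : cone) (S : set (set 'rV[R]_(rk s))) :
  catover RPCf.
Proof.
apply: (@CatOver RPCf
  (fun r => {g : cone_hom r s | lattice_embedding g /\ S (himg g)})
  (fun r r' (f : face_hom r r') x y => sval x = cone_comp f (sval y))).
- by move=> r x; apply: (@seqc_idl RPC).
- move=> t u v f g h -> x y z -> ->; exact: (@seqcA RPC).
all: by move=> *; apply: Prop_irrelevance.
Defined.

Lemma fan_proj_arr (s : cone) (S : set (set 'rV[R]_(rk s))) (r r' : cone)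
    (f : cone_hom r r') (p : so_ob (fan_cone_stack S) r)
    (q : so_ob (fan_cone_stack S) r') (a : so_arr f p q) :
  cone_comp (so_h p) (sval (so_c p)) =
  cone_comp f (cone_comp (so_h q) (sval (so_c q))).
Proof.
rewrite (so_m a : sval (so_c p) = cone_comp (so_k a) (sval (so_c q))).
apply: etrans (@seqcA RPC _ _ _ _ _ _ _) _.
by rewrite /= so_e; apply: (esym (@seqcA RPC _ _ _ _ _ _ _)).
Qed.

Definition fan_proj (s : cone) (S : set (set 'rV[R]_(rk s))) :
  functor (stack_of (fan_cone_stack S)) (@rep RPC s).
Proof.
apply: (@Functor RPC (stack_of (fan_cone_stack S)) (@rep RPC s)
  (fun r p => cone_comp (so_h p) (sval (so_c p)))
  (fun r r' f p q a => fan_proj_arr a)).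
all: by move=> *; apply: (@Prop_irrelevance (_ = _ :> cone_hom _ _)).
Defined.

Definition subdivision_of_cone (s : cone) (W : catover RPC)
    (p : functor W (@rep RPC s)) : Prop :=
  exists S : set (set 'rV[R]_(rk s)), fan_subdividing S /\
    exists E : functor (stack_of (fan_cone_stack S)) W,
      equivalence E /\ isomorphic (fcomp p E) (fan_proj S).

Definition subdivision (Y X : catover RPC) (F : functor Y X) : Prop :=
  forall (s : RPC) (g : functor (rep s) X),
    subdivision_of_cone (fp_proj2 F g).

(* A group object X -> Z in stacks whose base changes to cones are sheaves:
   its functor of points is a presheaf of groups on Z (a sheaf, the topology
   being chaotic), and X is the stack of pairs of an object of Z and a section
   over it.  All group objects considered here are commutative. *)
Record group_object (X Z : catover RPC) (pi : functor X Z) := GroupObject {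
  go_sheaf : presheaf Z;
  go_map : functor X (elements go_sheaf);
  go_equiv : equivalence go_map;
  go_over : isomorphic (fcomp (elements_proj go_sheaf) go_map) pi }.

Definition is_zero_section (X Z : catover RPC) (pi : functor X Z)
    (G : group_object pi) (e : functor Z X) : Prop :=
  isomorphic (fcomp (go_map G) e) (zero_elements (go_sheaf G)).

Definition group_iso (Z : catover RPC) (G H : presheaf Z) : Prop :=
  exists q : forall (s : RPC) (x : Z s), G s x -> H s x,
    [/\ forall s x u v, q s x (u + v) = q s x u + q s x v,
        forall s x, bijective (q s x)
      & forall (s t : RPC) (f : hom s t) (x : Z s) (y : Z t) (a : arr f x y) u,
          q s x (res G a u) = res H a (q t y u)].

(* The arrow over f : r -> t in the stack represented by s, from the
   composite with f of an object h over t, to h. *)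
Definition rep_arr (s r t : RPC) (f : hom r t) (h : hom t s) :
  @arr RPC (rep s) r t f (seqc f h) h := erefl.

(* Hom(N_t, Z^n) consists of the matrices with rk t rows and n columns. *)
Definition tropical_tori (Z : catover RPC) (G : presheaf Z) : Prop :=
  forall (s : RPC) (g : functor (rep s) Z),
  exists (n : nat)
    (q : forall (t : RPC) (h : hom t s), 'M[int]_(rk t, n) -> G t (g t h)),
    [/\ forall t h A B, q t h (A + B) = q t h A + q t h B,
        forall t h, bijective (q t h)
      & forall (r t : RPC) (f : hom r t) (h : hom t s) (A : 'M[int]_(rk t, n)),
          q r (seqc f h) (hmx f *m A) = res G (fa g (rep_arr f h)) (q t h A)].

Definition dual_cone (t : cone) : set 'cV[int]_(rk t) :=
  [set u | forall x, cset t x -> 0 <= (x *m realmx u) 0 0].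

(* M is the lattice Z^n, written as columns. *)
Definition admissible_form (s : cone) (n : nat)
    (Q : 'cV[int]_n -> 'cV[int]_n -> 'cV[int]_(rk s)) : Prop :=
  [/\ forall m m', Q m m' = Q m' m,
      forall m1 m2 m, Q (m1 + m2) m = Q m1 m + Q m2 m
    & forall m, m != 0 -> dual_cone (Q m m) /\ Q m m != 0].

(* A homomorphism phi from M to M_t is a matrix with rk t rows and n columns. *)
Definition bounded_hom (s : cone) (n : nat)
    (Q : 'cV[int]_n -> 'cV[int]_n -> 'cV[int]_(rk s))
    (t : cone) (h : cone_hom t s) : set 'M[int]_(rk t, n) :=
  [set phi | forall m, exists m1 m2,
     dual_cone (phi *m m - hmx h *m Q m1 m) /\
     dual_cone (hmx h *m Q m2 m - phi *m m)].

(* q presents the base change of G to the cone s as the quotient of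
   Hom(M, Gm)^(M) by the image of M; its values outside Hom(M, Gm)^(M) are
   irrelevant. *)
Definition tropical_abelian_varieties (Z : catover RPC) (G : presheaf Z) :
  Prop :=
  forall (s : RPC) (g : functor (rep s) Z),
  exists (n : nat) (Q : 'cV[int]_n -> 'cV[int]_n -> 'cV[int]_(rk s))
    (q : forall (t : RPC) (h : hom t s), 'M[int]_(rk t, n) -> G t (g t h)),
    admissible_form Q /\
    [/\ forall t h phi psi, bounded_hom Q h phi -> bounded_hom Q h psi ->
          q t h (phi + psi) = q t h phi + q t h psi,
        forall t h u, exists phi, bounded_hom Q h phi /\ q t h phi = u,
        forall t h phi, bounded_hom Q h phi ->
          (q t h phi = 0 <->
           exists m0, forall m, phi *m m = hmx h *m Q m0 m)
      & forall (r t : RPC) (f : hom r t) (h : hom t s) phi,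
          bounded_hom Q h phi ->
          q r (seqc f h) (hmx f *m phi) =
          res G (fa g (rep_arr f h)) (q t h phi)].

Definition split_semiabelian (X Z : catover RPC) (pi : functor X Z)
    (G : group_object pi) : Prop :=
  exists A T : presheaf Z,
    [/\ tropical_abelian_varieties A, tropical_tori T
      & group_iso (go_sheaf G) (presheaf_prod A T)].

Definition minimal (X Y : catover RPC) (F : functor Y X) : Prop :=
  forall (Y1 Y2 : catover RPC) (F1 : functor Y1 X) (S : functor Y2 Y1),
    fibred_in_groupoids Y1 -> fibred_in_groupoids Y2 -> subdivision S ->
    forall H : over_mor (fcomp F1 S) F,
      exists K : over_mor F1 F,
        over_isomorphic (over_precomp K S) H /\
        forall K' : over_mor F1 F,
          over_isomorphic (over_precomp K' S) H -> over_isomorphic K' K.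

Section Compactifications.
Variables (X Z : catover RPC) (pi : functor X Z) (G : group_object pi).

Definition partial_compactification (Y : catover RPC) (F : functor Y X) :
  Prop :=
  [/\ fibred_in_groupoids Y, monomorphism F,
      representable_by_finite_cone_stacks F
    & exists z : functor Z Y, is_zero_section G (fcomp F z)].

Definition generalized_partial_compactification (Y : catover RPC)
    (F : functor Y X) : Prop :=
  [/\ fibred_in_groupoids Y, monomorphism F
    & exists (Y' : catover RPC) (S : functor Y' Y),
        subdivision S /\ partial_compactification (fcomp F S)].

Definition birationally_equivalent (Y1 Y2 : catover RPC) (F1 : functor Y1 X)
    (F2 : functor Y2 X) : Prop :=
  exists (Y3 : catover RPC) (F3 : functor Y3 X)
    (S1 : over_mor F3 F1) (S2 : over_mor F3 F2),
    [/\ generalized_partial_compactification F3,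
        subdivision S1 & subdivision S2].

Definition birational_class
    (K : forall Y : catover RPC, functor Y X -> Prop) : Prop :=
  exists (Y0 : catover RPC) (F0 : functor Y0 X),
    generalized_partial_compactification F0 /\
    forall (Y : catover RPC) (F : functor Y X),
      K Y F <-> generalized_partial_compactification F /\
                birationally_equivalent F0 F.

End Compactifications.

Definition isomorphic_over (X Y1 Y2 : catover RPC) (F1 : functor Y1 X)
    (F2 : functor Y2 X) : Prop :=
  exists K : over_mor F1 F2, equivalence K.

(* The morphism g : s -> X corresponds to the object g(id) of X over s. *)
Definition in_MY (X Y : catover RPC) (F : functor Y X) (s : RPC) (x : X s) :
  Prop :=
  exists g : functor (rep s) X,
    (exists a : arr (idc s) (g s (idc s)) x, invertible a) /\
    exists S : set (set 'rV[R]_(rk s)), fan_subdividing S /\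
      exists L : functor (stack_of (fan_cone_stack S)) Y,
        isomorphic (fcomp F L) (fcomp g (fan_proj S)).

Definition MY (X Y : catover RPC) (F : functor Y X) : catover RPC :=
  full_sub (@in_MY X Y F).

Definition MY_incl (X Y : catover RPC) (F : functor Y X) :
  functor (MY F) X := full_sub_incl (@in_MY X Y F).

End Cones.

Arguments cone : clear implicits.
Arguments RPC : clear implicits.
Arguments RPCf : clear implicits.

(* Main.v *)
(* A monomorphism [F : Y -> X] is determined by its essential image, a class of
   objects of X stable under pullback, and it is a subdivision exactly when over
   every object of X over a cone s this class consists of the morphisms to s
   that land in a cone of some fan subdividing s.  A finite family of rational
   cones covering s is refined by a fan, so membership in [MY] may be tested on
   covers; hence [MY] is a stack and saturating twice adds nothing, which gives
   minimality.

   The geometric point is that [Y -> MY] is a subdivision.  Over a cone s with a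
   morphism to [MY], the pullback of Y is a finite cone stack, fully faithful
   over s, whose image contains a fan subdividing s.  Comparing lattice points
   in the interiors of its cones shows that each of them embeds into s as a
   saturated subcone and that two of them meet along a common face, so that
   they form a fan.

   Uniqueness of the minimal element follows by applying minimality to the
   intersection of two subdivisions of the base point of the class. *)
From mathcomp Require Import all_boot all_order all_algebra.
From mathcomp Require Import all_classical all_reals topology normedtype.
Require Import Defs.

Set Implicit Arguments.
Unset Strict Implicit.
Unset Printing Implicit Defensive.

Import Order.TTheory GRing.Theory Num.Theory.
Import numFieldNormedType.Exports.
Local Open Scope classical_set_scope.
Local Open Scope ring_scope.

(** * Essential images and monomorphisms *)

(** Lattice points of a cone are its morphisms from a ray. Full faithfulness, read over the ray
    alone, says that two charts of a cone stack with a common lattice point in their interiors are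
    joined by arrows of the cone stack in both directions. The obstacle is that a chart of an
    abstract cone stack could a priori have a kernel, miss lattice points of its span, or meet
    another chart badly. Finiteness of the arrows excludes a kernel; the covering fan supplies a
    chart through every lattice point and so excludes missing ones; pullback to faces turns boundary
    points into interior points and controls intersections. Convex geometry has to keep lattice
    points available throughout: cones pass between generators and integral inequalities, relative
    interiors are given lattice points, and subcones are given the lattice of their span. *)

Lemma inhabited_sig (T : Type) : inhabited T -> T.
Proof.
by move=> h; apply: (projT1 (cid (let: inhabits t := h in ex_intro (fun=> True) t I))).
Qed.

Section Fibred.
Context {B : category}.
Implicit Types C D X : catover B.

(** Only an arrow over the identity is asked for; it is invertible by [fibred_inv] as soon as [X] is
    fibred in groupoids. *)
Definition ess_image C X (F : functor C X) (s : B) (x : X s) : Prop :=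
  exists y : C s, inhabited (arr (idc s) (F s y) x).

Lemma fibred_cancel X (s t u : B) (f : hom s t) (g : hom t u) (h : hom s u)
    (e : h = seqc f g) (x : X s) (y : X t) (z : X u) (a a' : arr f x y)
    (b : arr g y z) :
  fibred_in_groupoids X -> cmp e a b = cmp e a' b -> a = a'.
Proof.
move=> [_ /(_ _ _ _ _ _ _ e _ _ _ b (cmp e a' b)) [a0 [_ u0]]] E.
by rewrite -(u0 a E) -(u0 a').
Qed.

(** Lifting the identity of [y] through [a] gives an inverse on one side; the other composite is
    compared with the identity after composing with [a], which can be cancelled. *)
Lemma fibred_inv X (s : B) (x y : X s) (a : arr (idc s) x y) :
  fibred_in_groupoids X -> invertible a.
Proof.
move=> fX.
have [_ /(_ _ _ _ _ _ _ (seqc_idl (idc s)) _ _ _ a (ida y))] := fX.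
move=> [b [ba _]]; exists b; split=> //.
apply: (fibred_cancel (e := seqc_idl (idc s)) (b := a) fX).
rewrite -(cmpA (seqc_idl _) (seqc_idl _) (seqc_idl _) (seqc_idl _)) ba.
by rewrite cmp_idr cmp_idl.
Qed.

Lemma fibred_sym X (s : B) (x y : X s) : fibred_in_groupoids X ->
  inhabited (arr (idc s) x y) -> inhabited (arr (idc s) y x).
Proof. by move=> fX [a]; have [b _] := fibred_inv a fX; exists. Qed.

Lemma arr_trans X (s t u : B) (f : hom s t) (g : hom t u) (x : X s) (y : X t)
    (z : X u) :
  inhabited (arr f x y) -> inhabited (arr g y z) ->
  inhabited (arr (seqc f g) x z).
Proof. by move=> [a] [b]; exists; apply: cmp a b. Qed.

Lemma arr_lift X (s t u : B) (f : hom s t) (g : hom t u) (h : hom s u)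
    (x : X s) (y : X t) (z : X u) : fibred_in_groupoids X -> h = seqc f g ->
  inhabited (arr g y z) -> inhabited (arr h x z) -> inhabited (arr f x y).
Proof.
by move=> [_ fX] e [b] [c]; have [a _] := fX _ _ _ _ _ _ e _ _ _ b c; exists.
Qed.

Lemma arr_idl X (s t : B) (f : hom s t) (x x' : X s) (y : X t) :
  inhabited (arr (idc s) x x') -> inhabited (arr f x' y) ->
  inhabited (arr f x y).
Proof. by move=> a b; rewrite (seqc_idl f); apply: arr_trans a b. Qed.

Lemma arr_idr X (s t : B) (f : hom s t) (x : X s) (y y' : X t) :
  inhabited (arr f x y) -> inhabited (arr (idc t) y y') ->
  inhabited (arr f x y').
Proof. by move=> a b; rewrite (seqc_idr f); apply: arr_trans a b. Qed.

Lemma arr_fa C D (F : functor C D) (s t : B) (f : hom s t) (x : C s) (y : C t) :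
  inhabited (arr f x y) -> inhabited (arr f (F s x) (F t y)).
Proof. by move=> [a]; exists; apply: fa a. Qed.

Lemma nat_iso_arr C D (F G : functor C D) (n : nat_iso F G) (s : B) (x : C s) :
  inhabited (arr (idc s) (F s x) (G s x)).
Proof. by exists; apply: n. Qed.

Lemma nat_iso_arrV C D (F G : functor C D) (n : nat_iso F G) (s : B) (x : C s) :
  inhabited (arr (idc s) (G s x) (F s x)).
Proof. by have [b _] := ni_inv n x; exists. Qed.

Lemma ess_image_pullback C X (F : functor C X) (s t : B) (f : hom s t)
    (x : X s) (y : X t) :
  fibred_in_groupoids C -> fibred_in_groupoids X ->
  inhabited (arr f x y) -> ess_image F y -> ess_image F x.
Proof.
move=> [pC _] fX xy [c cy]; have [c' c'c] := pC _ _ f c; exists c'.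
apply: (arr_lift fX (seqc_idl f) xy).
exact: arr_idr (arr_fa F c'c) cy.
Qed.

Lemma ess_image_iso C X (F : functor C X) (s : B) (x y : X s) :
  fibred_in_groupoids X ->
  inhabited (arr (idc s) x y) -> ess_image F y -> ess_image F x.
Proof.
by move=> fX xy [c cy]; exists c; apply: arr_idl cy (fibred_sym fX xy).
Qed.

Lemma ess_image_obj C X (F : functor C X) (s : B) (c : C s) :
  ess_image F (F s c).
Proof. by exists c; exists; apply: ida. Qed.

Lemma ess_image_over C D X (F : functor C X) (G : functor D X)
    (K : over_mor F G) (s : B) (x : X s) : ess_image F x -> ess_image G x.
Proof.
move=> [c cx]; exists (K s c).
exact: arr_idl (nat_iso_arr (om_iso K) c) cx.
Qed.

Lemma mono_inj C X (F : functor C X) (s t : B) (f : hom s t) (x : C s) (y : C t)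
  (a a' : arr f x y) : monomorphism F -> fa F a = fa F a' -> a = a'.
Proof.
move=> /(_ _ _ _ _ _ (fa F a')) [a0 [_ u]] E.
by rewrite -(u a E) -(u a').
Qed.

Lemma mono_arr C X (F : functor C X) (s t : B) (f : hom s t) (x : C s) (y : C t) :
  monomorphism F -> inhabited (arr f (F s x) (F t y)) -> inhabited (arr f x y).
Proof. by move=> mF [b]; have [a _] := mF _ _ _ _ _ b; exists. Qed.

Lemma mono_inv C X (F : functor C X) (s : B) (x y : C s) (a : arr (idc s) x y) :
  monomorphism F -> fibred_in_groupoids X -> invertible a.
Proof.
move=> mF fX; have [b [ab ba]] := fibred_inv (fa F a) fX.
have [b' [b'E _]] := mF _ _ _ _ _ b; exists b'.
by split; apply: (mono_inj mF); rewrite fa_cmp b'E fa_id.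
Qed.

(** Choose a preimage under [F] of each [H s c], up to isomorphism. Conjugating by these
    isomorphisms and full faithfulness determine the action on arrows, so functoriality follows from
    uniqueness. *)
Lemma mono_lift C D X (H : functor C X) (F : functor D X) :
  fibred_in_groupoids X -> monomorphism F ->
  (forall s (c : C s), ess_image F (H s c)) -> inhabited (over_mor H F).
Proof.
move=> fX mF im.
pose o s c := sval (cid (im s c)).
pose i s c : arr (idc s) (F s (o s c)) (H s c) :=
  inhabited_sig (svalP (cid (im s c))).
have ex s t (f : hom s t) (x : C s) (y : C t) (u : arr f x y) :
    exists a : arr f (o s x) (o t y),
      cmp (seqc_idl f) (i s x) (fa H u) = cmp (seqc_idr f) (fa F a) (i t y).
  have [_ /(_ _ _ _ _ _ _ (seqc_idr f) _ _ _ (i t y)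
             (cmp (seqc_idl f) (i s x) (fa H u)))[b [bE _]]] := fX.
  by have [a [aE _]] := mF _ _ _ _ _ b; exists a; rewrite aE bE.
pose m s t f x y u := sval (cid (ex s t f x y u)).
have mE s t f x y u : cmp (seqc_idl f) (i s x) (fa H u) =
    cmp (seqc_idr f) (fa F (m s t f x y u)) (i t y).
  exact: svalP (cid (ex s t f x y u)).
have uniq s t f x y u a : cmp (seqc_idl f) (i s x) (fa H u) =
    cmp (seqc_idr f) (fa F a) (i t y) -> m s t f x y u = a.
  rewrite mE => E; apply: (mono_inj mF).
  exact: fibred_cancel fX E.
have m_id s x : m s s (idc s) x x (ida x) = ida (o s x).
  by apply: uniq; rewrite !fa_id cmp_idl cmp_idr.
have m_cmp s t u f g h (e : h = seqc f g) x y z a b :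
    m s u h x z (cmp e a b) = cmp e (m s t f x y a) (m t u g y z b).
  apply: uniq; rewrite !fa_cmp (cmpA (seqc_idl f) e e) mE.
  rewrite -(cmpA (seqc_idr f) e (seqc_idl g) e) mE.
  by rewrite (cmpA e (seqc_idr h) (seqc_idr g) e).
pose L := @Functor _ C D o m m_id m_cmp.
have iI s x : invertible (i s x) by apply: fibred_inv.
by exists; exists L; apply: (@NatIso _ _ _ (fcomp F L) H i mE iI).
Qed.

(** With [mono_lift], this reduces morphisms over [X] into a monomorphism to inclusions of essential
    images; in particular the uniqueness clause of [minimal] is automatic there. *)
Lemma mono_lift_unique C D X (H : functor C X) (F : functor D X)
    (K L : over_mor H F) :
  fibred_in_groupoids X -> monomorphism F -> over_isomorphic K L.
Proof.
move=> fX mF.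
pose k := om_iso K; pose l := om_iso L.
have ex s (x : C s) : exists d : arr (idc s) (K s x) (L s x),
    cmp (seqc_idl (idc s)) (fa F d) (l s x) = k s x.
  have [_ /(_ _ _ _ _ _ _ (seqc_idl (idc s)) _ _ _ (l s x) (k s x))] := fX.
  by move=> [b [bE _]]; have [d [dE _]] := mF _ _ _ _ _ b; exists d; rewrite dE.
pose d s x := sval (cid (ex s x)).
have dE s x : cmp (seqc_idl (idc s)) (fa F (d s x)) (l s x) = k s x.
  exact: svalP (cid (ex s x)).
have dN s t (f : hom s t) (x : C s) (y : C t) (a : arr f x y) :
    cmp (seqc_idl f) (d s x) (fa L a) = cmp (seqc_idr f) (fa K a) (d t y).
  apply: (mono_inj mF); rewrite !fa_cmp.
  apply: (fibred_cancel (e := seqc_idr f) (b := l t y) fX).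
  rewrite -(cmpA (seqc_idl f) (seqc_idr f) (seqc_idr f) (seqc_idl f)).
  rewrite -(ni_nat l a).
  rewrite (cmpA (seqc_idl (idc s)) (seqc_idl f) (seqc_idl f) (seqc_idl f)).
  rewrite dE (ni_nat k a) -dE.
  by rewrite (cmpA (seqc_idr f) (seqc_idr f) (seqc_idl (idc t)) (seqc_idr f)).
have dI s x : invertible (d s x) by apply: mono_inv.
by exists (@NatIso _ _ _ _ _ d dN dI).
Qed.

Definition nat_iso_id C X (F : functor C X) : nat_iso F F.
Proof.
apply: (@NatIso _ _ _ F F (fun s x => ida (F s x))) => [*|s x].
  by rewrite cmp_idl cmp_idr.
by exists (ida (F s x)); rewrite cmp_idl.
Defined.

(** A strict equality, so that it can be rewritten with: the data agree by conversion and the laws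
    are propositions. *)
Lemma fcomp_fid C D (F : functor C D) : fcomp F (fid C) = F.
Proof.
case: F => fo fa i c; rewrite /fcomp /=.
by rewrite (Prop_irrelevance (fun s x => _) i) (Prop_irrelevance (fun s t u => _) c).
Qed.

Definition over_id C X (F : functor C X) : over_mor F F.
Proof. by exists (fid C); rewrite fcomp_fid; apply: nat_iso_id. Defined.

Lemma invertible_comp X (s : B) (x y z : X s) (a : arr (idc s) x y)
    (b : arr (idc s) y z) (e : idc s = seqc (idc s) (idc s)) :
  invertible a -> invertible b -> invertible (cmp e a b).
Proof.
move=> [a' [aa' a'a]] [b' [bb' b'b]]; exists (cmp (seqc_idl _) b' a').
rewrite -(cmpA _ _ (seqc_idl _) (seqc_idl _)) (cmpA (seqc_idl _) (seqc_idl _) _ _ b).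
rewrite bb' cmp_idl aa'; split=> //.
rewrite -(cmpA _ _ (seqc_idl _) (seqc_idl _)) (cmpA (seqc_idl _) (seqc_idl _) _ _ a').
by rewrite a'a cmp_idl b'b.
Qed.

Definition over_comp C D E X (F : functor C X) (G : functor D X) (H : functor E X)
  (K : over_mor F G) (L : over_mor G H) : over_mor F H.
Proof.
exists (fcomp L K).
apply: (@NatIso _ _ _ (fcomp H (fcomp L K)) F
  (fun s x => cmp (seqc_idl (idc s)) (om_iso L s (K s x)) (om_iso K s x))).
  move=> s t f x y a.
  rewrite -(cmpA (seqc_idl (idc s)) _ (seqc_idl f) (seqc_idl f)).
  rewrite (ni_nat (om_iso K) a).
  rewrite (cmpA (seqc_idl f) (seqc_idr f) (seqc_idr f)).
  rewrite (ni_nat (om_iso L) (fa K a)).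
  by rewrite (cmpA (seqc_idr f) (seqc_idr f)).
move=> s x; apply: invertible_comp; first exact: (ni_inv (om_iso L) (K s x)).
exact: (ni_inv (om_iso K) x).
Defined.

Lemma mono_equivalence C D X (F : functor C X) (G : functor D X)
    (K : over_mor F G) :
  fibred_in_groupoids X -> monomorphism F -> monomorphism G ->
  (forall s (d : D s), ess_image F (G s d)) -> equivalence K.
Proof.
move=> fX mF mG /(mono_lift fX mF) [L]; exists L; split.
  by have [d _] := mono_lift_unique (over_comp K L) (over_id F) fX mF; exists.
by have [d _] := mono_lift_unique (over_comp L K) (over_id G) fX mG; exists.
Qed.

Lemma equivalence_faithful C D (E : functor C D) (G : functor D C)
    (n : nat_iso (fcomp G E) (fid C)) (s t : B) (f : hom s t) (x : C s) (y : C t)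
    (a a' : arr f x y) : fa E a = fa E a' -> a = a'.
Proof.
move=> aa'; have : cmp (seqc_idl f) (n s x) a = cmp (seqc_idl f) (n s x) a'.
  by rewrite (ni_nat n a) (ni_nat n a') /= aa'.
have [b [_ bn]] := ni_inv n x.
move=> /(congr1 (cmp (seqc_idl f) b)).
rewrite !(cmpA (seqc_idl (idc s)) (seqc_idl f) (seqc_idl f) (seqc_idl f)) bn.
by rewrite !cmp_idl.
Qed.

Lemma equivalence_mono C D (E : functor C D) : equivalence E -> monomorphism E.
Proof.
move=> [G [[n] [m]]] s t f x y b.
have [n' [nn' n'n]] := ni_inv n x.
pose a : arr f x y :=
  cmp (seqc_idl f) n' (cmp (seqc_idr f) (fa G b) (n t y)).
have aE : cmp (seqc_idl f) (n s x) a = cmp (seqc_idr f) (fa G b) (n t y).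
  by rewrite /a (cmpA (seqc_idl (idc s)) (seqc_idl f) _ (seqc_idl f)) nn' cmp_idl.
have EaE : fa E a = b.
  (* Fullness: the images of [a] and [b] are compared after applying [G], which is faithful because
     it is an equivalence too. *)
  apply: (equivalence_faithful m).
  have := ni_nat n a; rewrite /= aE => {}aE.
  have [p [np _]] := ni_inv n y.
  have := congr1 (fun z => cmp (seqc_idr f) z p) aE.
  by rewrite -!(cmpA _ _ (seqc_idl (idc t)) (seqc_idr f)) np !cmp_idr => ->.
exists a; split=> // a' a'E.
by apply: (equivalence_faithful n); rewrite EaE.
Qed.

Lemma mono_comp C D E (F : functor C D) (G : functor D E) :
  monomorphism F -> monomorphism G -> monomorphism (fcomp G F).
Proof.
move=> mF mG s t f x y b; have [a' [a'E u']] := mG _ _ _ _ _ b.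
have [a [aE u]] := mF _ _ _ _ _ a'; exists a; split; first by rewrite /= aE.
by move=> c /u' cE; apply: u.
Qed.

Lemma mono_of_comp C D E (F : functor C D) (G : functor D E) :
  monomorphism G -> monomorphism (fcomp G F) -> monomorphism F.
Proof.
move=> mG mGF s t f x y b; have [a [aE u]] := mGF _ _ _ _ _ (fa G b).
by exists a; split=> [|c cE]; [apply: (mono_inj mG) | apply: u; rewrite /= cE].
Qed.

Lemma full_sub_incl_mono C (P : forall s, C s -> Prop) :
  monomorphism (full_sub_incl P).
Proof. by move=> s t f x y b; exists b; split. Qed.

Lemma full_sub_fibred C (P : forall s, C s -> Prop) :
  fibred_in_groupoids C ->
  (forall s t (f : hom s t) (x : C s) (y : C t),
     inhabited (arr f x y) -> P t y -> P s x) ->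
  fibred_in_groupoids (full_sub P).
Proof.
move=> [pC uC] clP; split=> [s t f [y Py]|s t u f g h e x y z b c]; last exact: uC.
have [x xy] := pC s t f y; exists (exist _ x (clP _ _ _ _ _ xy Py)); exact: xy.
Qed.

Lemma rep_arr_irrelevance (s t u : B) (f : hom t u) (h : rep s t) (k : rep s u)
    (a b : arr f h k) : a = b.
Proof. exact: (@Prop_irrelevance (h = seqc f k)). Qed.

Lemma rep_fibred (s : B) : fibred_in_groupoids (rep s).
Proof.
split=> [t u f y|t u v f g h e x y z b c]; first by exists (seqc f y); exists.
have a : arr f x y by move: b c => /= -> ->; rewrite e seqcA.
by exists a; split=> [|a' _]; apply: rep_arr_irrelevance.
Qed.

Lemma rep_arr_eq (s t u : B) (f : hom t u) (h : rep s t) (k : rep s u) :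
  inhabited (arr f h k) -> h = seqc f k.
Proof. by case. Qed.

Lemma ess_image_rep C (s t : B) (F : functor C (rep s)) (h : rep s t) :
  ess_image F h <-> exists c, F t c = h.
Proof.
split=> [[c [/= ch]]|[c <-]]; last exact: ess_image_obj.
by exists c; rewrite ch -seqc_idl.
Qed.

(** The functor sends [h] to a chosen pullback of [x] along [h]; uniqueness of lifts makes any such
    choice strictly functorial. *)
Lemma yoneda X (s : B) (x : X s) : fibred_in_groupoids X ->
  exists g : functor (rep s) X,
    forall t (h : rep s t), inhabited (arr h (g t h) x).
Proof.
move=> fX; have [pX uX] := fX.
pose o t (h : rep s t) := sval (cid (pX t s h x)).
pose i t h : arr h (o t h) x := inhabited_sig (svalP (cid (pX t s h x))).
have ex t u (f : hom t u) (h : rep s t) (k : rep s u) (e : arr f h k) :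
    exists a : arr f (o t h) (o u k), cmp (e : h = seqc f k) a (i u k) = i t h.
  by have [a [aE _]] := uX _ _ _ _ _ _ (e : h = seqc f k) _ _ _ (i u k) (i t h);
    exists a.
pose m t u f h k e := sval (cid (ex t u f h k e)).
have mE t u f h k e : cmp (e : h = seqc f k) (m t u f h k e) (i u k) = i t h.
  exact: svalP (cid (ex t u f h k e)).
have m_id t h : m t t (idc t) h h (ida h) = ida (o t h).
  apply: (fibred_cancel (e := seqc_idl h) (b := i t h) fX).
  rewrite cmp_idl; have := mE t t _ h h (ida h).
  by rewrite (Prop_irrelevance (ida h : h = seqc (idc t) h) (seqc_idl h)).
have m_cmp t u v f g h (e : h = seqc f g) p q r a b :
    m t v h p r (cmp e a b) = cmp e (m t u f p q a) (m u v g q r b).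
  pose pE : p = seqc h r := @cmp _ (rep s) _ _ _ _ _ _ e _ _ _ a b.
  apply: (fibred_cancel (e := pE) (b := i v r) fX).
  rewrite (mE _ _ _ _ _ (cmp e a b)).
  by rewrite -(cmpA _ _ (b : q = seqc g r) (a : p = seqc f q)) mE mE.
by exists (@Functor _ (rep s) X o m m_id m_cmp) => t h; exists; apply: i.
Qed.

Lemma functor_rep_arr X (s : B) (g : functor (rep s) X) t (h : rep s t) :
  inhabited (arr h (g t h) (g s (idc s))).
Proof. by exists; apply: (fa g); apply: seqc_idr. Qed.

Lemma ess_image_fp_proj2 C D X (F : functor C X) (G : functor D X) (s : B) (d : D s) :
  fibred_in_groupoids D -> fibred_in_groupoids X ->
  ess_image (fp_proj2 F G) d <-> ess_image F (G s d).
Proof.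
move=> fD fX; split=> [[p /= pd]|[c [i]]].
  exists (fp_l p); apply: arr_idl (arr_fa G pd); exists; exact: fp_i p.
pose p : fibre_product F G s := FpOb (fibred_inv i fX).
by exists p; exists; apply: ida.
Qed.

Lemma fp_proj2_mono C D X (F : functor C X) (G : functor D X) :
  fibred_in_groupoids X -> monomorphism F -> monomorphism (fp_proj2 F G).
Proof.
move=> fX mF s t f p q b.
have [_ /(_ _ _ _ _ _ _ (seqc_idr f) _ _ _ (fp_i q)
         (cmp (seqc_idl f) (fp_i p) (fa G b)))[c [cE _]]] := fX.
have [a [aE u]] := mF _ _ _ _ _ c; rewrite -aE in cE.
exists (FpMor (esym cE)); split=> // a' /= a'b.
apply: fp_mor_eq => //=; apply: (mono_inj mF).
apply: (fibred_cancel (e := seqc_idr f) (b := fp_i q) fX).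
by rewrite cE -fp_mP a'b.
Qed.

End Fibred.

(** * Rational polyhedral cones *)

Arguments cset {R} c _.

Section Polyhedra.
Context {R : realType}.
Implicit Types n : nat.

Definition dot n (x : 'rV[R]_n) (u : 'cV[R]_n) : R := (x *m u) 0 0.

Lemma dotDl n (x y : 'rV[R]_n) u : dot (x + y) u = dot x u + dot y u.
Proof. by rewrite /dot mulmxDl mxE. Qed.

Lemma dotZl n c (x : 'rV[R]_n) u : dot (c *: x) u = c * dot x u.
Proof. by rewrite /dot -scalemxAl mxE. Qed.

Lemma dotNl n (x : 'rV[R]_n) u : dot (- x) u = - dot x u.
Proof. by rewrite /dot mulNmx mxE. Qed.

Lemma dotDr n (x : 'rV[R]_n) u v : dot x (u + v) = dot x u + dot x v.
Proof. by rewrite /dot mulmxDr mxE. Qed.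

Lemma dotZr n c (x : 'rV[R]_n) u : dot x (c *: u) = c * dot x u.
Proof. by rewrite /dot -scalemxAr mxE. Qed.

Lemma dotNr n (x : 'rV[R]_n) u : dot x (- u) = - dot x u.
Proof. by rewrite /dot mulmxN mxE. Qed.

Lemma dot0l n u : dot (0 : 'rV[R]_n) u = 0.
Proof. by rewrite /dot mul0mx mxE. Qed.

Lemma dot0r n (x : 'rV[R]_n) : dot x 0 = 0.
Proof. by rewrite /dot mulmx0 mxE. Qed.

Lemma dot_sumr n I (r : seq I) (P : pred I) (x : 'rV[R]_n) F :
  dot x (\sum_(i <- r | P i) F i) = \sum_(i <- r | P i) dot x (F i).
Proof. by rewrite /dot mulmx_sumr summxE. Qed.

Lemma dot_suml n I (r : seq I) (P : pred I) F (u : 'cV[R]_n) :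
  dot (\sum_(i <- r | P i) F i) u = \sum_(i <- r | P i) dot (F i) u.
Proof. by rewrite /dot mulmx_suml summxE. Qed.

Lemma dotM m n (x : 'rV[R]_m) (A : 'M[R]_(m, n)) u :
  dot (x *m A) u = dot x (A *m u).
Proof. by rewrite /dot mulmxA. Qed.

Lemma dot_eq0 n (x : 'rV[R]_n) u : x *m u = 0 <-> dot x u = 0.
Proof.
rewrite /dot; split=> [->|xu]; first by rewrite mxE.
by apply/rowP => j; rewrite ord1 xu mxE.
Qed.

Lemma dotE n (x : 'rV[R]_n) u : dot x u = \sum_i x 0 i * u i 0.
Proof. by rewrite /dot mxE. Qed.

Lemma dot_tr_gt0 n (u : 'cV[R]_n) : u != 0 -> 0 < dot u^T u.
Proof.
move=> u0; rewrite dotE lt_neqAle eq_sym; apply/andP; split; last first.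
  by apply: sumr_ge0 => i _; rewrite mxE -expr2 sqr_ge0.
apply: contra u0; rewrite psumr_eq0 => [/allP h|i _]; last first.
  by rewrite mxE -expr2 sqr_ge0.
apply/eqP/colP => i; have := h i (mem_index_enum i).
by rewrite !mxE -expr2 sqrf_eq0 => /eqP.
Qed.

Lemma realmxD m n (A B : 'M[int]_(m, n)) :
  realmx (A + B) = realmx A + realmx B :> 'M[R]_(m, n).
Proof. exact: (map_mxD (intmul (1 : R))). Qed.

Lemma realmxN m n (A : 'M[int]_(m, n)) : realmx (- A) = - realmx A :> 'M[R]_(m, n).
Proof. exact: (map_mxN (intmul (1 : R))). Qed.

Lemma realmxZ m n (a : int) (A : 'M[int]_(m, n)) :
  realmx (a *: A) = a%:~R *: realmx A :> 'M[R]_(m, n).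
Proof. exact: (map_mxZ (intmul (1 : R))). Qed.

Lemma realmx0 m n : realmx (0 : 'M[int]_(m, n)) = 0 :> 'M[R]_(m, n).
Proof. exact: (map_mx0 (intmul (1 : R))). Qed.

Lemma realmx_inj m n : injective (@realmx R m n).
Proof.
move=> A B /matrixP E; apply/matrixP => i j.
by have := E i j; rewrite !mxE => /(@intr_inj R).
Qed.

Lemma realmx_tr m n (A : 'M[int]_(m, n)) : realmx A^T = (realmx A)^T :> 'M[R]_(n, m).
Proof. by rewrite /realmx map_trmx. Qed.

Lemma realmx_row m n (A : 'M[int]_(m, n)) i :
  realmx (row i A) = row i (realmx A) :> 'rV[R]_n.
Proof. by rewrite /realmx map_row. Qed.

Lemma dot_int n (x : 'rV[int]_n) (u : 'cV[int]_n) :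
  dot (realmx x) (realmx u) = ((x *m u) 0 0)%:~R.
Proof. by rewrite /dot -realmxM mxE. Qed.

Lemma dot_tr n (x : 'rV[R]_n) (u : 'cV[R]_n) : dot u^T x^T = dot x u.
Proof. by rewrite /dot -trmx_mul mxE. Qed.

Definition hcone n (us : seq 'cV[int]_n) : set 'rV[R]_n :=
  [set x | forall u, u \in us -> 0 <= dot x (realmx u)].

Lemma hconeD n (us : seq 'cV[int]_n) x y : hcone us x -> hcone us y -> hcone us (x + y).
Proof. by move=> xu yu u uu; rewrite dotDl addr_ge0 ?xu ?yu. Qed.

Lemma hconeZ n (us : seq 'cV[int]_n) c x : 0 <= c -> hcone us x -> hcone us (c *: x).
Proof. by move=> c0 xu u uu; rewrite dotZl mulr_ge0 ?xu. Qed.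

Lemma cone_span_nil n : cone_span [::] = [set (0 : 'rV[R]_n)].
Proof.
apply/seteqP; split=> [x [c [_ ->]]|x ->]; first by rewrite big_ord0.
by exists (fun=> 0); rewrite big_ord0.
Qed.

Lemma cone_span_cons n (g : 'rV[int]_n) gs (x : 'rV[R]_n) :
  cone_span (g :: gs) x <-> exists c, 0 <= c /\ cone_span gs (x - c *: realmx g).
Proof.
split=> [[c [c0 ->]]|[a [a0 [c [c0 cE]]]]].
  exists (c ord0); split; first exact: c0.
  exists (fun i => c (lift ord0 i)); split=> //.
  by rewrite big_ord_recl /= addrAC subrr add0r.
exists (fun i => oapp c a (unlift ord0 i)); split=> [i|].
  by case: unlift.
rewrite big_ord_recl unlift_none /= -[LHS](subrK (a *: realmx g)) cE addrC.
by congr (_ + _); apply: eq_bigr => i _; rewrite liftK.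
Qed.

(** Fourier-Motzkin elimination of [c]. Functionals negative on [g] bound [c] below, positive ones
    bound it above; each pair of bounds gives the integral functional [d u *: v - d v *: u], and the
    upper bounds are also compared with 0, which keeps [u] itself when [0 <= d u]. *)
Lemma hcone_ray n (us : seq 'cV[int]_n) (g : 'rV[int]_n) :
  exists us', forall x,
    hcone us' x <-> exists c, 0 <= c /\ hcone us (x - c *: realmx g).
Proof.
pose d (u : 'cV[int]_n) : int := (g *m u) 0 0.
pose r u : R := dot (realmx g) (realmx u).
have rd u : r u = (d u)%:~R by apply: dot_int.
have rge u : (0 <= r u) = (0 <= d u) by rewrite rd ler0z.
have rgt u : (0 < r u) = (0 < d u) by rewrite rd ltr0z.
have rlt u : (r u < 0) = (d u < 0) by rewrite rd ltrz0.
exists ([seq u <- us | 0 <= d u] ++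
        [seq d u *: v - d v *: u | u <- [seq u <- us | 0 < d u],
                                    v <- [seq v <- us | d v < 0]]) => x.
split=> [hx|[c [c0 hx]] w].
  (* The least admissible coefficient: the largest of the lower bounds, including 0. *)
  pose c := \big[Num.max/0]_(v <- us | d v < 0) (dot x (realmx v) / r v).
  exists c; split; first exact: bigmax_ge_id.
  move=> u uu; rewrite dotDl dotNl dotZl -/(r u) subr_ge0.
  have [du|du|du] := ltrgtP (d u) 0.
  - have : dot x (realmx u) / r u <= c.
      exact: (Order.TotalTheory.le_bigmax_seq 0 u (fun v => d v < 0)
          (fun v => dot x (realmx v) / r v) uu du).
    by rewrite ler_ndivrMr // rlt.
  - rewrite -ler_pdivlMr ?rgt //.
    rewrite /c big_seq_cond; apply: bigmax_le => [|v /andP[vv dv]].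
      apply: divr_ge0; last by rewrite rge ltW.
      by apply: hx; rewrite mem_cat mem_filter uu ltW.
    rewrite ler_ndivrMr ?rlt // mulrAC ler_pdivrMr ?rgt //.
    have : 0 <= dot x (realmx (d u *: v - d v *: u)).
      apply: hx; rewrite mem_cat; apply/orP; right.
      by apply: allpairs_f; rewrite mem_filter ?uu ?vv ?du ?dv.
    rewrite realmxD realmxN !realmxZ -!rd dotDr dotNr !dotZr subr_ge0.
    by rewrite [X in X <= _]mulrC [X in _ <= X]mulrC.
  - rewrite rd du mulr0.
    by apply: hx; rewrite mem_cat mem_filter uu du lexx.
rewrite mem_cat => /orP[|/allpairsP [[u v] /= [+ + ->]]].
  rewrite mem_filter => /andP [du /hx].
  rewrite dotDl dotNl dotZl subr_ge0; apply: le_trans.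
  by rewrite mulr_ge0 // -/(r w) rge.
rewrite !mem_filter => /andP [du uu] /andP [dv vv].
rewrite realmxD realmxN !realmxZ -!rd dotDr dotNr !dotZr.
have := hx _ uu; have := hx _ vv; rewrite !dotDl !dotNl !dotZl -/(r u) -/(r v).
rewrite !subr_ge0 => xv xu; rewrite -rgt in du; rewrite -rlt in dv.
have h1 : r u * (c * r v) <= r u * dot x (realmx v) by rewrite ler_pM2l.
have h2 : r v * dot x (realmx u) <= r v * (c * r u) by rewrite ler_nM2l.
by apply: (le_trans h2); apply: le_trans h1; rewrite mulrCA [r v * r u]mulrC mulrCA.
Qed.

(** The generators are added one at a time, each by an elimination step; the zero cone is cut out by
    the coordinates and their negatives. *)
Lemma cone_span_hcone n (gens : seq 'rV[int]_n) :
  exists us, cone_span gens = hcone us.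
Proof.
elim: gens => [|g gs [us IH]].
  exists ([seq delta_mx i 0 | i <- enum 'I_n] ++
          [seq - delta_mx i 0 | i <- enum 'I_n]).
  have dotd (x : 'rV[R]_n) i : dot x (realmx (delta_mx i 0)) = x 0 i.
    rewrite dotE (bigD1 i) //= big1 => [|j /negPf ji].
      by rewrite !mxE !eqxx mulr1 addr0.
    by rewrite !mxE ji mulr0.
  rewrite cone_span_nil; apply/seteqP; split=> [x -> u _|x hx /=].
    by rewrite dot0l.
  apply/rowP => i; rewrite mxE; apply/eqP; rewrite eq_le; apply/andP; split.
    have := hx (- delta_mx i 0); rewrite realmxN dotNr dotd oppr_ge0; apply.
    rewrite mem_cat; apply/orP; right.
    by apply: (map_f (fun i => - delta_mx i 0)); rewrite mem_enum.
  have := hx (delta_mx i 0); rewrite dotd; apply.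
  rewrite mem_cat; apply/orP; left.
  by apply: (map_f (fun i => delta_mx i 0)); rewrite mem_enum.
have [us' us'E] := hcone_ray us g; exists us'; apply/seteqP.
by split=> x; rewrite us'E cone_span_cons IH.
Qed.

Lemma cone_span_mem n (gens : seq 'rV[int]_n) g :
  g \in gens -> @cone_span R n gens (realmx g).
Proof.
move=> gg; have := gg; rewrite -index_mem => ig.
by have := @cone_span_gen R n gens (Ordinal ig); rewrite /= nth_index.
Qed.

Lemma cone_span_dot_ge0 n (gens : seq 'rV[int]_n) (u : 'cV[R]_n) x :
  (forall g, g \in gens -> 0 <= dot (realmx g) u) ->
  cone_span gens x -> 0 <= dot x u.
Proof.
move=> h [c [c0 ->]]; rewrite dot_suml sumr_ge0 // => i _.
by rewrite dotZl mulr_ge0 // h // mem_nth.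
Qed.

(** By duality: the inequalities [vs] of the cone spanned by the transposed [us] become, transposed
    again, the generators. An inequality [w] valid on these generators lies in the span of [us],
    hence is nonnegative on [hcone us]. *)
Lemma hcone_cone_span n (us : seq 'cV[int]_n) :
  exists gens, hcone us = @cone_span R n gens.
Proof.
have [vs vsE] := cone_span_hcone [seq u^T | u <- us].
pose gens := [seq v^T | v <- vs]; exists gens.
have [ws wsE] := cone_span_hcone gens.
apply/seteqP; split=> [x hx|x]; last first.
  move=> gx u uu; apply: cone_span_dot_ge0 gx => _ /mapP [v vv ->].
  rewrite -dot_tr -!realmx_tr trmxK.
  have : @cone_span R n [seq u^T | u <- us] (realmx u^T).
    by apply: cone_span_mem; apply: map_f.
  by rewrite vsE; apply.
rewrite wsE => w ww.
have : @hcone n vs (realmx w^T).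
  move=> v vv; have : @cone_span R n gens (realmx v^T).
    by apply: cone_span_mem; apply: map_f.
  by rewrite wsE => /(_ w ww); rewrite -dot_tr -!realmx_tr trmxK.
rewrite -vsE => hw; have : 0 <= dot (realmx w^T) x^T.
  apply: cone_span_dot_ge0 hw => _ /mapP [u uu ->].
  by rewrite realmx_tr dot_tr; apply: hx.
by rewrite realmx_tr dot_tr.
Qed.

(** Intersections and preimages are immediate from inequalities, images and faces from generators;
    this passes between the two. *)
Lemma rational_polyhedralP n (S : set 'rV[R]_n) :
  rational_polyhedral S <-> exists us, S = hcone us.
Proof.
split=> [[gens ->]|[us ->]]; first exact: cone_span_hcone.
by have [gens ->] := hcone_cone_span us; exists gens.
Qed.

Lemma rational_polyhedralI n (S T : set 'rV[R]_n) :
  rational_polyhedral S -> rational_polyhedral T -> rational_polyhedral (S `&` T).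
Proof.
move=> /rational_polyhedralP [us ->] /rational_polyhedralP [vs ->].
apply/rational_polyhedralP; exists (us ++ vs); apply/seteqP.
split=> [x [xu xv] u|x xuv].
  by rewrite mem_cat => /orP [/xu|/xv].
by split=> u uu; apply: xuv; rewrite mem_cat uu ?orbT.
Qed.

Lemma rational_polyhedral_preimage m n (A : 'M[int]_(m, n)) (S : set 'rV[R]_n) :
  rational_polyhedral S -> rational_polyhedral [set x | S (x *m realmx A)].
Proof.
move=> /rational_polyhedralP [us ->]; apply/rational_polyhedralP.
exists [seq A *m u | u <- us]; apply/seteqP; split=> [x xu _ /mapP [u uu ->]|x xu u uu].
  by rewrite realmxM -dotM; apply: xu.
by rewrite dotM -realmxM; apply/xu/map_f.
Qed.

Lemma cone_span_map m n (A : 'M[int]_(m, n)) (gens : seq 'rV[int]_m) :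
  [set x *m realmx A | x in @cone_span R m gens] = cone_span [seq g *m A | g <- gens].
Proof.
elim: gens => [|g gs IH].
  by rewrite /= !cone_span_nil image_set1 mul0mx.
apply/seteqP; split=> [_ [x + <-]|y] /=.
  move=> /cone_span_cons [c [c0 cx]]; apply/cone_span_cons; exists c; split=> //.
  by rewrite -IH realmxM scalemxAl -mulmxBl; exists (x - c *: realmx g).
move=> /cone_span_cons [c [c0]]; rewrite -IH realmxM => -[x gx xE].
exists (x + c *: realmx g); last by rewrite mulmxDl xE -scalemxAl subrK.
by apply/cone_span_cons; exists c; rewrite addrK.
Qed.

Lemma rational_polyhedral_image m n (A : 'M[int]_(m, n)) (S : set 'rV[R]_m) :
  rational_polyhedral S -> rational_polyhedral [set x *m realmx A | x in S].
Proof. by move=> [gens ->]; exists [seq g *m A | g <- gens]; apply: cone_span_map. Qed.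

Lemma rational_polyhedralD n (S : set 'rV[R]_n) x y :
  rational_polyhedral S -> S x -> S y -> S (x + y).
Proof. by move=> /rational_polyhedralP [us ->]; apply: hconeD. Qed.

Lemma rational_polyhedralZ n (S : set 'rV[R]_n) c x :
  rational_polyhedral S -> 0 <= c -> S x -> S (c *: x).
Proof. by move=> /rational_polyhedralP [us ->]; apply: hconeZ. Qed.

(** A nonnegative combination killed by [u] can only involve generators killed by [u]. As [u] is
    real, this shows that every face is rational and that there are finitely many. *)
Lemma cone_span_face n (gens : seq 'rV[int]_n) (u : 'cV[R]_n) :
  (forall g, g \in gens -> 0 <= dot (realmx g) u) ->
  [set x | cone_span gens x /\ dot x u = 0] =
  cone_span [seq g <- gens | dot (realmx g) u == 0].
Proof.
elim: gens => [|g gs IH] h /=.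
  by rewrite cone_span_nil; apply/seteqP; split=> [x []|x ->] //=; rewrite dot0l.
have g0 : 0 <= dot (realmx g) u by apply: h; rewrite mem_head.
have hs g' : g' \in gs -> 0 <= dot (realmx g') u.
  by move=> g'g; apply: h; rewrite inE g'g orbT.
have key x : cone_span (g :: gs) x /\ dot x u = 0 <->
    exists c, [/\ 0 <= c, c * dot (realmx g) u = 0 &
      cone_span [seq g <- gs | dot (realmx g) u == 0] (x - c *: realmx g)].
  rewrite -IH //; split=> [[/cone_span_cons [c [c0 cx]] xu]|[c [c0 cg [cx]]]].
    have := cone_span_dot_ge0 hs cx; rewrite dotDl dotNl dotZl xu add0r oppr_ge0.
    have cg := mulr_ge0 c0 g0 => cg'.
    have cgE : c * dot (realmx g) u = 0 by apply/eqP; rewrite eq_le cg cg'.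
    by exists c; split=> //; split=> //; rewrite dotDl dotNl dotZl xu cgE subr0.
  rewrite dotDl dotNl dotZl cg subr0 => xu; split=> //.
  by apply/cone_span_cons; exists c.
have [gu|gu] := eqVneq (dot (realmx g) u) 0; apply/seteqP; split=> x /=.
- by move=> /key [c [c0 _ cx]]; apply/cone_span_cons; exists c.
- move=> /cone_span_cons [c [c0 cx]]; apply/key; exists c; split=> //.
  by rewrite gu mulr0.
- move=> /key [c [_ /eqP]]; rewrite mulf_eq0 (negPf gu) orbF => /eqP ->.
  by rewrite scale0r subr0.
- by move=> gx; apply/key; exists 0; rewrite mul0r scale0r subr0.
Qed.

Lemma face_ofE n (F S : set 'rV[R]_n) :
  face_of F S <-> exists u, (forall x, S x -> 0 <= dot x u) /\
                            F = [set x | S x /\ dot x u = 0].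
Proof.
by split=> -[u [u0 ->]]; exists u; split=> //; apply/seteqP; split=> x [Sx xu];
  split=> //; apply/dot_eq0.
Qed.

Lemma face_of_sub n (F S : set 'rV[R]_n) : face_of F S -> F `<=` S.
Proof. by move=> [u [_ ->]] x []. Qed.

Lemma face_of_refl n (S : set 'rV[R]_n) : face_of S S.
Proof.
apply/face_ofE; exists 0; split=> [x _|]; first by rewrite dot0r.
by apply/seteqP; split=> [x Sx|x []] //; split=> //; rewrite dot0r.
Qed.

Lemma face_of_span n (gens : seq 'rV[int]_n) (F : set 'rV[R]_n) :
  face_of F (cone_span gens) -> exists a : pred 'rV[int]_n,
    F = cone_span [seq g <- gens | a g].
Proof.
move=> /face_ofE [u [u0 ->]]; exists (fun g => dot (realmx g) u == 0).
by rewrite -cone_span_face // => g gg; apply/u0/cone_span_mem.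
Qed.

Lemma rational_polyhedral_face n (F S : set 'rV[R]_n) :
  rational_polyhedral S -> face_of F S -> rational_polyhedral F.
Proof. by move=> [gens ->] /face_of_span [a ->]; eexists. Qed.

Lemma finite_faces n (S : set 'rV[R]_n) :
  rational_polyhedral S -> finite_set [set F | face_of F S].
Proof.
move=> [gens ->].
apply: (@sub_finite_set _ _ [set cone_span (mask (m : (size gens).-tuple bool) gens) |
  m in [set: (size gens).-tuple bool]]).
  move=> F /face_of_span [a ->] /=.
  by exists (map_tuple a (in_tuple gens)) => //=; rewrite -filter_mask.
by apply: finite_image; apply: finite_finset.
Qed.

End Polyhedra.

(** * Relative interiors and lattices *)

Section RelativeInterior.
Context {R : realType}.
Implicit Types n : nat.

(** The relative interior in terms of supporting functionals, a form that passes through linear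
    images without affine spans or topology; for the full-dimensional cones of [RPC] it is the
    interior ([interior_relint]). *)
Definition relint n (S : set 'rV[R]_n) (w : 'rV[R]_n) : Prop :=
  S w /\ forall u, (forall x, S x -> 0 <= dot x u) -> dot w u = 0 ->
    forall x, S x -> dot x u = 0.

Lemma hcone0 n (us : seq 'cV[int]_n) : hcone us (0 : 'rV[R]_n).
Proof. by move=> u _; rewrite dot0l. Qed.

Lemma rational_polyhedral0 n (S : set 'rV[R]_n) : rational_polyhedral S -> S 0.
Proof. by move=> /rational_polyhedralP [us ->]; apply: hcone0. Qed.

Lemma rational_polyhedral_sum n (S : set 'rV[R]_n) I (r : seq I) F :
  rational_polyhedral S -> (forall i, S (F i)) -> S (\sum_(i <- r) F i).
Proof.
move=> rS SF; elim/big_ind: _ => // [|x y]; first exact: rational_polyhedral0.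
exact: rational_polyhedralD.
Qed.

(** The sum of the generators works: a nonnegative functional vanishing on it vanishes on each of
    them. *)
Lemma relint_exists n (S : set 'rV[R]_n) : rational_polyhedral S ->
  exists w : 'rV[int]_n, relint S (realmx w).
Proof.
move=> rS; have [gens SE] := rS.
pose g (i : 'I_(size gens)) : 'rV[R]_n := realmx (nth 0 gens i).
have gS i : S (g i) by rewrite SE; apply: cone_span_gen.
have wE : realmx (\sum_(i < size gens) nth 0 gens i) = \sum_(i < size gens) g i.
  by elim/big_ind2: _ => [|_ a _ b <- <-|] //; [rewrite realmx0 | rewrite realmxD].
exists (\sum_(i < size gens) nth 0 gens i); rewrite wE; split.
  exact: rational_polyhedral_sum.
move=> u u0 /eqP; rewrite dot_suml psumr_eq0 => [/allP h x|i _]; last exact: u0.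
rewrite SE => -[c [_ ->]]; rewrite dot_suml big1 // => i _.
have /eqP := h i (mem_index_enum i); rewrite dotZl => ->.
by rewrite mulr0.
Qed.

Lemma archi_step n (us : seq 'cV[int]_n) (w x : 'rV[R]_n) :
  exists N : nat, forall c, N%:R <= c -> forall u, u \in us ->
    0 < dot w (realmx u) -> 0 < c * dot w (realmx u) + dot x (realmx u).
Proof.
(* When the denominator is 0 the quotient is 0 by convention, so the sum over all of [us] still
   bounds each ratio. *)
pose q (u : 'cV[int]_n) := `|dot x (realmx u)| / `|dot w (realmx u)|.
have q0 u : 0 <= q u by apply: divr_ge0.
have s0 : 0 <= \sum_(u <- us) q u by apply: sumr_ge0.
exists (Num.bound (\sum_(u <- us) q u)) => c hc u uu wu.
have qu : q u <= \sum_(u <- us) q u.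
  rewrite (big_rem u) //= lerDl; exact: sumr_ge0.
have {hc} : q u < c by apply: le_lt_trans qu (lt_le_trans (archi_boundP s0) hc).
rewrite /q (gtr0_norm wu) ltr_pdivrMr // => h.
rewrite -ltrBlDr sub0r; apply: le_lt_trans h.
by rewrite -normrN ler_norm.
Qed.

Lemma min_face n (T : set 'rV[R]_n) w : rational_polyhedral T -> T w ->
  exists F, face_of F T /\ relint F w.
Proof.
move=> /rational_polyhedralP [us ->] wT.
(* The sum of the inequalities that are tight at [w]: on the cone it vanishes exactly where all of
   them do. *)
pose u0 : 'cV[R]_n := \sum_(u <- us | dot w (realmx u) == 0) realmx u.
exists [set x | hcone us x /\ dot x u0 = 0].
have u0_ge0 x : hcone us x -> 0 <= dot x u0.
  move=> xT; rewrite dot_sumr big_seq_cond; apply: sumr_ge0 => u /andP[uu _].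
  exact: xT.
have wu0 : dot w u0 = 0 by rewrite dot_sumr big1 // => u /eqP.
split; first by apply/face_ofE; exists u0.
split=> // u uF wu x [xT xu0].
have xu v : v \in us -> dot w (realmx v) = 0 -> dot x (realmx v) = 0.
  move=> vv wv; move/eqP: xu0.
  rewrite dot_sumr big_seq_cond psumr_eq0 => [|v' /andP [vv' _]].
    by move=> /allP /(_ v vv); rewrite vv wv eqxx /= => /eqP.
  exact: xT.
(* For large [N] the point [N%:R *: w - x] still lies in the face, so [u] is nonnegative both there
   and at [x], while it vanishes at [w]. *)
have [N NP] := archi_step us w (- x).
have h : hcone us (N%:R *: w - x).
  move=> v vv; rewrite dotDl dotNl dotZl.
  have := wT v vv; rewrite le_eqVlt => /orP [/eqP/esym wv|wv].
    by rewrite wv (xu v vv wv) mulr0 subr0.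
  by have := NP _ (lexx _) v vv wv; rewrite dotNl => /ltW.
have xu_ge0 : 0 <= dot x u by apply: uF.
apply/eqP; rewrite eq_le xu_ge0 andbT -oppr_ge0.
have : 0 <= dot (N%:R *: w - x) u.
  by apply: uF; split=> //; rewrite dotDl dotNl dotZl wu0 xu0 mulr0 subr0.
by rewrite dotDl dotNl dotZl wu mulr0 sub0r.
Qed.

Lemma relint_face_sub n (F F' S : set 'rV[R]_n) w :
  face_of F S -> F' `<=` S -> relint F' w -> F w -> F' `<=` F.
Proof.
move=> /face_ofE [u [u0 ->]] FS [_ ri] [_ wu] x F'x; split; first exact: FS.
by apply: (ri u) => // y /FS; apply: u0.
Qed.

Lemma relint_image m n (A : 'M[R]_(m, n)) (S : set 'rV[R]_m) w :
  relint S w -> relint [set x *m A | x in S] (w *m A).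
Proof.
move=> [Sw ri]; split; first by exists w.
move=> u u0; rewrite dotM => wu _ [x Sx <-]; rewrite dotM; apply: ri => // y Sy.
by rewrite -dotM; apply: u0; exists y.
Qed.

Lemma relint_image_inj m n (A : 'M[R]_(m, n)) (S : set 'rV[R]_m) w :
  row_free A -> relint [set x *m A | x in S] (w *m A) -> relint S w.
Proof.
move=> fA [[w' Sw' /(row_free_inj fA) ww'] ri]; subst w'; split=> // u u0 wu x Sx.
have [P AP] := row_freeP fA.
have PE y : dot (y *m A) (P *m u) = dot y u by rewrite dotM mulmxA AP mul1mx.
rewrite -PE; apply: ri; last by exists x.
  by move=> _ [y Sy <-]; rewrite PE; apply: u0.
by rewrite PE.
Qed.

Lemma nbhs_dot_gt0 n (p : 'rV[R]_n) (u : 'cV[R]_n) :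
  0 < dot p u -> nbhs p [set q | 0 < dot q u].
Proof.
move=> pu; pose s := 1 + \sum_i `|u i 0|.
have s1 : 1 <= s by rewrite lerDl sumr_ge0.
have s0 : 0 < s by apply: lt_le_trans s1.
apply/nbhs_ballP; exists (dot p u / s) => /=; first by rewrite divr_gt0.
move=> q [_ /(_ 0)] pq /=.
suff : dot (p - q) u < dot p u by rewrite dotDl dotNl ltrBlDr ltrDl.
apply: le_lt_trans (_ : dot p u / s * \sum_i `|u i 0| < _); last first.
  rewrite mulrAC ltr_pdivrMr // ltr_pM2l //.
  by rewrite /s addrC ltrDl.
rewrite dotE mulr_sumr; apply: ler_sum => i _.
apply: le_trans (ler_norm _) _; rewrite normrM ler_wpM2r //.
by have := pq i; rewrite /ball /= !mxE => /ltW.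
Qed.

Lemma interior_hcone n (us : seq 'cV[int]_n) (p : 'rV[R]_n) :
  (forall u, u \in us -> 0 < dot p (realmx u)) -> interior (hcone us) p.
Proof.
move=> pu; have fp := nbhs_filter p.
have : nbhs p [set q | forall u, u \in us -> 0 < dot q (realmx u)].
  elim: us pu => [|u us IH] pu.
    by apply: (@filterS _ _ fp setT) => //; apply: filterT.
  have := @filterI _ _ fp _ _ (nbhs_dot_gt0 (pu u (mem_head _ _)))
    (IH (fun v vv => pu v (mem_behead (s := u :: us) vv))).
  by apply: (@filterS _ _ fp) => q [qu qus] v; rewrite inE => /orP [/eqP ->|/qus].
by apply: (@filterS _ _ fp) => q h u uu; apply/ltW/h.
Qed.

Lemma interior_dot_gt0 n (S : set 'rV[R]_n) (p : 'rV[R]_n) (u : 'cV[R]_n) :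
  interior S p -> (forall x, S x -> 0 <= dot x u) -> u != 0 -> 0 < dot p u.
Proof.
move=> /nbhs_ballP [e /= e0 pe] Su u0.
pose s := 1 + \sum_i `|u i 0|.
have s1 : 1 <= s by rewrite lerDl sumr_ge0.
have s0 : 0 < s by apply: lt_le_trans s1.
(* The entries of [u] are at most [s] in absolute value, so [t *: u^T] moves each coordinate of [p]
   by at most [e / 2]. *)
pose t := e / s / 2.
have t0 : 0 < t by rewrite !divr_gt0.
have : S (p - t *: u^T).
  apply: pe; split=> // i j; rewrite /ball /= !mxE opprB addrC subrK (ord1 i).
  rewrite normrM gtr0_norm // /t.
  have uj : `|u j 0| <= s.
    by rewrite /s (bigD1 j) //= addrCA lerDl addr_ge0 // sumr_ge0.
  apply: le_lt_trans (_ : e / s / 2 * s < _); first by rewrite ler_pM2l.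
  rewrite mulrAC divfK ?gt_eqF // ltr_pdivrMr // ltr_pMr // ltr1n //.
move=> /Su; rewrite dotDl dotNl dotZl subr_ge0; apply: lt_le_trans.
by rewrite mulr_gt0 // dot_tr_gt0.
Qed.

Lemma full_dot_eq0 (t : cone R) (u : 'cV[R]_(rk t)) :
  (forall x, cset t x -> dot x u = 0) -> u = 0.
Proof.
move=> h; apply/eqP; apply: contraT => /dot_tr_gt0.
have [x [y [tx [ty ->]]]] := cone_full u^T.
by rewrite dotDl dotNl !h // subr0 ltxx.
Qed.

(** Without zero functionals, the interior is exactly where all the inequalities are strict. *)
Lemma cone_hrep (t : cone R) : exists us : seq 'cV[int]_(rk t),
  cset t = hcone us /\ forall u, u \in us -> realmx u != 0 :> 'cV[R]_(rk t).
Proof.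
have /rational_polyhedralP [us usE] := cone_polyhedral t.
exists [seq u <- us | realmx u != 0 :> 'cV[R]_(rk t)]; split; last first.
  by move=> u; rewrite mem_filter => /andP [].
rewrite usE; apply/seteqP; split=> x xu u.
  by rewrite mem_filter => /andP [_ /xu].
move=> uu; have [->|u0] := eqVneq (realmx u : 'cV[R]_(rk t)) 0; first by rewrite dot0r.
by apply: xu; rewrite mem_filter u0.
Qed.

Lemma interior_relint (t : cone R) p : interior (cset t) p <-> relint (cset t) p.
Proof.
split=> [pt|[tp ri]].
  split=> [|u u0 pu x tx]; first exact: nbhs_singleton pt.
  have [->|un0] := eqVneq u 0; first by rewrite dot0r.
  by have := interior_dot_gt0 pt u0 un0; rewrite pu ltxx.
have [us [usE us0]] := cone_hrep t; rewrite usE; apply: interior_hcone => u uu.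
have h x : cset t x -> 0 <= dot x (realmx u) by rewrite usE => /(_ u uu).
rewrite lt_neqAle h // andbT eq_sym; apply: contra (us0 u uu) => /eqP pu.
by apply/eqP; apply: full_dot_eq0; apply: ri.
Qed.

Lemma interior_archi (t : cone R) (p x : 'rV[R]_(rk t)) : interior (cset t) p ->
  exists N : nat, forall c, N%:R <= c -> interior (cset t) (c *: p + x).
Proof.
move=> pt; have [us [usE us0]] := cone_hrep t; rewrite usE in pt *.
have pu u : u \in us -> 0 < dot p (realmx u).
  by move=> uu; apply: interior_dot_gt0 pt _ (us0 u uu) => y; apply.
have [N NP] := archi_step us p x; exists N => c Nc; apply: interior_hcone => u uu.
by rewrite dotDl dotZl; apply: NP => //; apply: pu.
Qed.

Lemma interior_scale (t : cone R) (p : 'rV[R]_(rk t)) c : 0 < c ->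
  interior (cset t) p -> interior (cset t) (c *: p).
Proof.
move=> c0 /interior_relint [tp ri]; apply/interior_relint; split.
  by apply: rational_polyhedralZ (ltW c0) tp; apply: cone_polyhedral.
move=> u u0; rewrite dotZl => /eqP; rewrite mulf_eq0 (gt_eqF c0) => /eqP.
exact: ri.
Qed.

Lemma cone_interior_exists (t : cone R) :
  exists w : 'rV[int]_(rk t), interior (cset t) (realmx w).
Proof.
have [w ri] := relint_exists (cone_polyhedral t).
by exists w; apply/interior_relint.
Qed.

End RelativeInterior.

(** * Saturated sublattices and embeddings of subcones *)

Section Lattices.
Context {R : realType}.

(** In Smith form [A = L D V], the rows of [V] at nonzero invariant factors form a basis [G] of the
    saturation of the row lattice of [A]. The rows of [Y] are the coordinates of the rows of [A],
    and [Z] witnesses that they span over the reals. *)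
Lemma lattice_basis m n (A : 'M[int]_(m, n)) :
  exists r (G : 'M[int]_(r, n)) (Y : 'M[int]_(m, r)) (Z : 'M[R]_(r, m)),
  [/\ injective (fun v : 'rV[int]_r => v *m G),
      forall w : 'rV[int]_n, (exists x : 'rV[R]_r, x *m realmx G = realmx w) ->
        exists v : 'rV[int]_r, v *m G = w,
      A = Y *m G & Z *m realmx Y = 1%:M].
Proof.
have [L uL [V uV [d _ AE]]] := int_Smith_normal_form A.
set D := (X in L *m X) in AE.
pose I := [pred j : 'I_n | (j < m)%N && (d`_j != 0)].
pose e (k : 'I_#|I|) : 'I_n := enum_val k.
have eI k : ((e k < m)%N && (d`_(e k) != 0)) by have := enum_valP k.
pose P : 'M[int]_(#|I|, n) := \matrix_(k, j) (e k == j)%:R.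
pose DE : 'M[int]_(m, #|I|) := \matrix_(i, k) D i (e k).
have DEP : D = DE *m P.
  apply/matrixP => i j; rewrite [RHS]mxE.
  have [jI|jI] := boolP (j \in I).
    rewrite (bigD1 (enum_rank_in jI j)) //= big1 => [|k kj].
      by rewrite [DE _ _]mxE [P _ _]mxE /e enum_rankK_in // eqxx mulr1 addr0.
    rewrite [P _ _]mxE; case: eqP => [ekj|]; last by rewrite mulr0.
    by case/eqP: kj; apply: enum_val_inj; rewrite enum_rankK_in.
  rewrite big1 => [|k _]; last first.
    rewrite [P _ _]mxE; case: eqP => [ekj|]; last by rewrite mulr0.
    by case/negP: jI; rewrite -ekj; apply: enum_valP.
  rewrite mxE; have [ij|] := eqVneq (i : nat) j; last by rewrite mulr0n.
  by move: jI; rewrite inE /= -ij ltn_ord /= negbK => /eqP ->; rewrite mul0rn.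
have PPt : P *m P^T = 1%:M.
  apply/matrixP => k l; rewrite !mxE (bigD1 (e k)) //= big1 => [|j /negPf ej].
    by rewrite !mxE eqxx mul1r addr0 (inj_eq enum_val_inj) eq_sym.
  by rewrite !mxE eq_sym ej mul0r.
(* The invariant factors are inverted here, so [Z] is real and not integral. *)
pose Z : 'M[R]_(#|I|, m) :=
  \matrix_(k, i) ((e k == i :> nat)%:R / (d`_(e k))%:~R) *m realmx (invmx L).
exists #|I|, (P *m V), (L *m DE), Z; split.
- move=> v w /= /(congr1 (fun x => x *m invmx V)).
  rewrite -!mulmxA mulmxV // mulmx1 => /(congr1 (fun x => x *m P^T)).
  by rewrite -!mulmxA PPt !mulmx1.
- move=> w [x xE]; exists (w *m invmx V *m P^T).
  suff -> : w *m invmx V *m P^T *m (P *m V) = w *m invmx V *m V by rewrite mulmxKV.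
  rewrite mulmxA; congr (_ *m _); apply: (@realmx_inj R).
  have wE : realmx (w *m invmx V) = x *m realmx P.
    rewrite realmxM -xE realmxM -!mulmxA; congr (_ *m _).
    by rewrite -[RHS]mulmx1 -realmxM mulmxV // realmx1.
  by rewrite !realmxM -realmxM wE -!mulmxA (mulmxA (realmx P)) -!realmxM PPt mul1mx.
- by rewrite AE {1}DEP !mulmxA.
- rewrite /Z -mulmxA realmxM (mulmxA (realmx (invmx L))) -realmxM mulVmx //.
  rewrite realmx1 mul1mx; apply/matrixP => k l; rewrite !mxE.
  have /andP [km dk] := eI k.
  rewrite (bigD1 (Ordinal km)) //= big1 => [|i ik].
    rewrite !mxE /= eqxx mul1r addr0 /e.
    have [kl|kl] := eqVneq k l.
      by rewrite kl eqxx mulr1n mulVf // intr_eq0 -kl.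
    rewrite (_ : (_ == _ :> nat) = false) ?mulr0n ?mulr0 //.
    by apply: contraNF kl => /eqP /val_inj /enum_val_inj ->.
  rewrite !mxE; case: eqP => [eki|]; last by rewrite mul0r mul0r.
  by case/eqP: ik; apply: val_inj.
Qed.

(** The new cone is [T] in the coordinates of a basis of the saturated lattice of its span; strong
    convexity is inherited from [s]. *)
Lemma subcone_embedding (s : cone R) (T : set 'rV[R]_(rk s)) :
  rational_polyhedral T -> T `<=` cset s ->
  exists r (g : cone_hom r s), lattice_embedding g /\ himg g = T.
Proof.
move=> [gens TE] Ts.
pose A : 'M[int]_(size gens, rk s) := \matrix_(i, j) nth 0 gens i 0 j.
have [r [G [Y [Z [injG satG AE ZY]]]]] := lattice_basis A.
pose ys := [seq row i Y | i <- enum 'I_(size gens)].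
have rys : rational_polyhedral (@cone_span R r ys) by exists ys.
have ysE : [seq y *m G | y <- ys] = gens.
  rewrite -map_comp -[RHS](mkseq_nth 0) /mkseq -val_enum_ord -map_comp.
  apply: eq_map => i /=; rewrite -row_mul -AE; apply/rowP => j.
  by rewrite !mxE.
have ysP : [set x *m realmx G | x in @cone_span R r ys] = T.
  by rewrite cone_span_map ysE TE.
have freeG := @row_free_realmx R _ _ _ injG.
have sc (x : 'rV[R]_r) : cone_span ys x -> cone_span ys (- x) -> x = 0.
  move=> yx yNx; apply: (row_free_inj freeG); rewrite mul0mx.
  apply: (@cone_strongly_convex R s); apply: Ts; rewrite -ysP; first by exists x.
  by exists (- x) => //; rewrite mulNmx.
have full (v : 'rV[R]_r) : exists x y, cone_span ys x /\ cone_span ys y /\ v = x - y.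
  (* [Z] writes [v] as a real combination of the generators; its positive and negative parts give
     the two points of the cone. *)
  pose c := v *m Z; pose a i := row i (realmx Y) : 'rV[R]_r.
  have ya i : cone_span ys (a i).
    rewrite /a -realmx_row; apply: cone_span_mem; apply: map_f.
    by rewrite mem_enum.
  exists (\sum_i Num.max (c 0 i) 0 *: a i), (\sum_i Num.max (- c 0 i) 0 *: a i).
  split; last split; try (apply: rational_polyhedral_sum => // i;
    by apply: rational_polyhedralZ; rewrite // le_max lexx orbT).
  rewrite -sumrB; transitivity (\sum_i c 0 i *: a i).
    by rewrite -[LHS]mulmx1 -ZY mulmxA mulmx_sum_row.
  apply: eq_bigr => i _; rewrite -scalerBl; congr (_ *: _).
  have [c0|c0] := leP 0 (c 0 i).
    by rewrite max_r ?subr0 // oppr_le0.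
  by rewrite max_l ?sub0r ?opprK // oppr_ge0 ltW.
pose t := Cone rys sc full.
have tG x : cset t x -> cset s (x *m realmx G).
  by move=> tx; apply: Ts; rewrite -ysP; exists x.
by exists t, (ConeHom tG).
Qed.

Lemma face_embedding (t : cone R) (F : set 'rV[R]_(rk t)) :
  face_of F (cset t) -> exists r (g : face_hom r t), himg g = F.
Proof.
move=> Ft; have rF := rational_polyhedral_face (cone_polyhedral t) Ft.
have [r [g [eg gF]]] := subcone_embedding rF (face_of_sub Ft).
by subst F; exists r, (FaceHom (conj eg Ft)).
Qed.

Lemma embedding_free (s t : cone R) (g : cone_hom s t) :
  lattice_embedding g -> row_free (realmx g : 'M[R]_(_, _)).
Proof. by move=> [injg _]; apply: row_free_realmx. Qed.

Lemma embedding_cancel (r s t : cone R) (k k' : cone_hom r s) (g : cone_hom s t) :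
  lattice_embedding g -> cone_comp k g = cone_comp k' g -> k = k'.
Proof.
move=> [injg _] /(congr1 (@hmx _ _ _)) /= E; apply: cone_hom_eq.
apply/row_matrixP => i; apply: injg.
by rewrite -!row_mul E.
Qed.

Lemma himg_sub (s t : cone R) (g : cone_hom s t) : himg g `<=` cset t.
Proof. by move=> _ [x sx <-]; apply: hmxP. Qed.

Lemma himg_comp (r s t : cone R) (k : cone_hom r s) (g : cone_hom s t) :
  himg (cone_comp k g) = [set x *m realmx g | x in himg k].
Proof.
rewrite /himg /= realmxM; apply/seteqP; split=> [_ [x rx <-]|_ [_ [x rx <-] <-]].
  by exists (x *m realmx k); [exists x | rewrite mulmxA].
by exists x; rewrite // mulmxA.
Qed.

Lemma himg_polyhedral (s t : cone R) (g : cone_hom s t) : rational_polyhedral (himg g).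
Proof. by apply: rational_polyhedral_image; apply: cone_polyhedral. Qed.

Lemma embedding_factor (r s t : cone R) (g : cone_hom s t) (h : cone_hom r t) :
  lattice_embedding g -> himg h `<=` himg g -> exists k, cone_comp k g = h.
Proof.
move=> eg hg; have [injg satg] := eg; have fg := embedding_free eg.
have row_ex i : exists v, v *m g = row i h.
  (* A basis vector is a difference of points of [r], so its image lies in the real span of the
     image of [g]; being integral, it lifts by saturation. *)
  apply: satg; have [x [y [rx [ry ixy]]]] := cone_full (row i 1%:M : 'rV[R]_(rk r)).
  have [a _ aE] : himg g (x *m realmx h) by apply: hg; exists x.
  have [b _ bE] : himg g (y *m realmx h) by apply: hg; exists y.
  exists (a - b); rewrite mulmxBl aE bE -mulmxBl -ixy -row_mul mul1mx.
  by rewrite realmx_row.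
pose K : 'M[int]_(rk r, rk s) := \matrix_(i, j) sval (cid (row_ex i)) 0 j.
have KE : K *m g = h.
  apply/row_matrixP => i; rewrite row_mul -(svalP (cid (row_ex i))).
  by congr (_ *m _); apply/rowP => j; rewrite !mxE.
have KP x : cset r x -> cset s (x *m realmx K).
  move=> rx; have [a sa aE] : himg g (x *m realmx h) by apply: hg; exists x.
  suff -> : x *m realmx K = a by [].
  by apply: (row_free_inj fg); rewrite aE -mulmxA -realmxM KE.
by exists (ConeHom KP); apply: cone_hom_eq.
Qed.

Lemma embedding_factor_face (r s t : cone R) (k : cone_hom r s) (g : cone_hom s t) :
  lattice_embedding g -> lattice_embedding (cone_comp k g) ->
  face_of (himg (cone_comp k g)) (himg g) -> face_morphism k.
Proof.
move=> eg [injkg satkg] /face_ofE [u [u0 uE]]; have fg := embedding_free eg.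
split; first split.
- by move=> v w /= vw; apply: injkg; rewrite /= !mulmxA vw.
- move=> w [v vE]; have [v' v'E] : exists v', v' *m cone_comp k g = w *m g.
    by apply: satkg; exists v; rewrite /= !realmxM mulmxA vE.
  by exists v'; apply: (proj1 eg); rewrite /= -mulmxA.
apply/face_ofE; exists (realmx g *m u); split=> [x sx|].
  by rewrite -dotM; apply: u0; exists x.
apply/seteqP; split=> [x kx|x [sx]].
  split; first exact: himg_sub kx.
  have : himg (cone_comp k g) (x *m realmx g) by rewrite himg_comp; exists x.
  by rewrite uE => -[_]; rewrite dotM.
rewrite -dotM => xu; have : himg (cone_comp k g) (x *m realmx g).
  by rewrite uE; split=> //; exists x.
by rewrite himg_comp => -[y ky /(row_free_inj fg) <-].
Qed.

Lemma face_of_image m n (A : 'M[R]_(m, n)) (F S : set 'rV[R]_m) :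
  row_free A -> face_of F S ->
  face_of [set x *m A | x in F] [set x *m A | x in S].
Proof.
move=> fA /face_ofE [u [u0 ->]]; have [P AP] := row_freeP fA.
have PE y : dot (y *m A) (P *m u) = dot y u by rewrite dotM mulmxA AP mul1mx.
apply/face_ofE; exists (P *m u); split=> [_ [x Sx <-]|]; first by rewrite PE u0.
apply/seteqP; split=> [_ [x [Sx xu] <-]|_ [[x Sx <-]]].
  by rewrite /= PE; split=> //; exists x.
by rewrite PE => xu; exists x.
Qed.

End Lattices.

(** * Fans *)

Section Fans.
Context {R : realType}.

Lemma face_ofI n (F1 F2 S : set 'rV[R]_n) :
  face_of F1 S -> face_of F2 S -> face_of (F1 `&` F2) F1.
Proof.
move=> /face_of_sub F1S /face_ofE [u [u0 ->]]; apply/face_ofE; exists u.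
split=> [x /F1S|]; first exact: u0.
by apply/seteqP; split=> [x [F1x [Sx xu]]|x [F1x xu]]; split=> //; split=> //;
  apply: F1S.
Qed.

Lemma fan_of_faces (s : cone R) (P : set (set 'rV[R]_(rk s))) :
  finite_set P -> (forall T, P T -> rational_polyhedral T) ->
  (forall T T', P T -> P T' -> face_of (T `&` T') T) ->
  \bigcup_(T in P) T = cset s ->
  fan_subdividing [set F | exists2 T, P T & face_of F T].
Proof.
move=> finP rP iP uP; split.
- apply: (@sub_finite_set _ _ (\bigcup_(T in P) [set F | face_of F T])).
    by move=> F [T PT FT]; exists T.
  by apply: bigcup_finite => // T /rP; apply: finite_faces.
- by move=> F [T /rP rT]; apply: rational_polyhedral_face.
- by move=> F F' [T PT FT] F'F; exists T => //; apply: face_of_trans F'F FT; apply: rP.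
- move=> F1 F2 [T1 P1 FT1] [T2 P2 FT2].
  (* Faces of two members are compared inside the common face [I]: a face of [T2] cuts [I] in a face
     of [I], hence in a face of [T1]. *)
  pose I := T1 `&` T2; have IT1 : face_of I T1 by apply: iP.
  have IT2 : face_of I T2 by rewrite /I setIC; apply: iP.
  have F2I : face_of (I `&` F2) T1.
    by apply: face_of_trans IT1; [apply: rP | apply: face_ofI IT2 FT2].
  have -> : F1 `&` F2 = F1 `&` (I `&` F2).
    apply/seteqP; split=> [x [f1 f2]|x [f1 [_ f2]]] //; split=> //; split=> //.
    by split; [apply: face_of_sub FT1 _ f1 | apply: face_of_sub FT2 _ f2].
  exact: face_ofI FT1 F2I.
- rewrite -uP; apply/seteqP; split=> [x [F [T PT FT] Fx]|x [T PT Tx]].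
    by exists T => //; apply: face_of_sub FT _ Fx.
  by exists T => //; exists T => //; apply: face_of_refl.
Qed.

Lemma fan_sub (s : cone R) S (T : set 'rV[R]_(rk s)) :
  fan_subdividing S -> S T -> T `<=` cset s.
Proof. by move=> [_ _ _ _ <-] ST x Tx; exists T. Qed.

Lemma trivial_fan (s : cone R) : exists S, fan_subdividing S /\ S (cset s).
Proof.
exists [set F | exists2 T, [set cset s] T & face_of F T]; split; last first.
  by exists (cset s) => //; apply: face_of_refl.
apply: fan_of_faces => [|T ->|T T' -> ->|]; first exact: finite_set1.
- exact: cone_polyhedral.
- by rewrite setIid; apply: face_of_refl.
- by rewrite bigcup_set1.
Qed.

Lemma finite_hrep n (P : set (set 'rV[R]_n)) : finite_set P ->
  (forall T, P T -> rational_polyhedral T) ->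
  exists us : seq 'cV[int]_n,
    forall T, P T -> exists2 vs, {subset vs <= us} & T = hcone vs.
Proof.
move=> /finite_seqP [l ->]; elim: l => [|T l IH] rP.
  by exists [::] => T; rewrite /= in_nil.
have [|us usP] := IH; first by move=> T' T'l; apply: rP; rewrite /= inE T'l orbT.
have [|vs vsE] := (rational_polyhedralP T).1; first by apply: rP; rewrite /= mem_head.
exists (vs ++ us) => T'; rewrite /= inE => /orP [/eqP ->|/usP [ws wu ->]].
  by exists vs => // u; rewrite mem_cat => ->.
by exists ws => // u /wu; rewrite mem_cat => ->; rewrite orbT.
Qed.

(* The fan is cut out by the arrangement of all hyperplanes that bound members
   of the cover. *)
Lemma cover_refinement (s : cone R) (P : set (set 'rV[R]_(rk s))) :
  finite_set P -> (forall T, P T -> rational_polyhedral T) ->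
  cset s `<=` \bigcup_(T in P) T ->
  exists S, fan_subdividing S /\ forall A, S A -> exists2 T, P T & A `<=` T.
Proof.
move=> finP rP cP; have [us usP] := finite_hrep finP rP.
have [us0 sE] := (rational_polyhedralP _).1 (cone_polyhedral s).
pose m := size us.
(* A cell is given by a choice of side for each hyperplane; [e i] true selects the side where the
   functional is nonpositive. *)
pose sg (e : {ffun 'I_m -> bool}) (i : 'I_m) : 'cV[int]_(rk s) :=
  (-1) ^+ e i *: nth 0 us i.
pose cell e : set 'rV[R]_(rk s) := hcone (us0 ++ [seq sg e i | i <- enum 'I_m]).
have cellP e x : cell e x <-> cset s x /\ forall i, 0 <= dot x (realmx (sg e i)).
  rewrite sE; split=> [cx|[sx ex] u].
    split=> [u uu|i]; apply: cx; rewrite mem_cat ?uu //.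
    by rewrite map_f ?orbT // mem_enum.
  by rewrite mem_cat => /orP [/sx|/mapP [i _ ->]].
have sgE e i : realmx (sg e i) = (-1) ^+ e i *: realmx (nth 0 us i) :> 'cV[R]_(rk s).
  by rewrite realmxZ rmorphXn /= rmorphN1.
have rcell e : rational_polyhedral (cell e) by apply/rational_polyhedralP; eexists.
exists [set F | exists2 T, [set cell e | e in setT] T & face_of F T]; split.
  apply: fan_of_faces.
  - exact/finite_image/finite_finset.
  - by move=> _ [e _ <-].
  - move=> _ _ [e _ <-] [e' _ <-]; apply/face_ofE.
    (* On the cell of [e] this sum vanishes exactly where every hyperplane separating the two cells
       vanishes. *)
    exists (\sum_(i | e i != e' i) realmx (sg e i)); split=> [x /cellP [_ ex]|].
      by rewrite dot_sumr sumr_ge0.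
    have opp i : e i != e' i -> realmx (sg e' i) = - realmx (sg e i) :> 'cV[R]_(rk s).
      by rewrite !sgE; case: (e i) (e' i) => [] [] //= _;
        rewrite ?expr1 ?expr0 ?scaleN1r ?scale1r ?opprK.
    apply/seteqP; split=> x.
      move=> [/cellP [sx ex] /cellP [_ e'x]]; split; first exact/cellP.
      rewrite dot_sumr big1 // => i ne; apply/eqP; rewrite eq_le ex andbT.
      by have := e'x i; rewrite opp // dotNr oppr_ge0.
    move=> [/cellP [sx ex] /eqP].
    rewrite dot_sumr psumr_eq0 => [/allP h|i _]; last exact: ex.
    split; apply/cellP; split=> // i; have [ee|ne] := eqVneq (e i) (e' i).
      by rewrite sgE -ee -sgE.
    have := h i (mem_index_enum i); rewrite ne /= => /eqP xi.
    by rewrite opp // dotNr xi oppr0.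
  - apply/seteqP; split=> [x [_ [e _ <-] /cellP []]|x sx] //.
    exists (cell [ffun i : 'I_m => dot x (realmx (nth 0 us i)) < 0]); first by eexists.
    apply/cellP; split=> // i; rewrite sgE ffunE dotZr.
    case: ltP => [xi|xi]; last by rewrite expr0 mul1r.
    by rewrite expr1 mulN1r oppr_ge0 ltW.
move=> A [_ [e _ <-] /face_of_sub Ae].
(* The member [T] containing a relative interior point [w] of the cell contains the whole cell: if
   an inequality of [T] is nonpositive on the cell, it vanishes at [w] and hence on the cell. *)
have [w [/cellP [sw ew] ri]] := relint_exists (rcell e).
have [T PT Tw] := cP _ sw; exists T => //; apply: subset_trans Ae _ => x ex.
have [vs vu TE] := usP T PT; rewrite TE in Tw *; move=> u uv.
have iu : (index u us < m)%N by rewrite index_mem vu.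
have := sgE e (Ordinal iu); rewrite /= nth_index ?vu //.
have [eu|eu] := boolP (e (Ordinal iu)).
  rewrite expr1 scaleN1r => sgN.
  have cell_le y : cell e y -> dot y (realmx u) <= 0.
    by move=> /cellP [_ /(_ (Ordinal iu))]; rewrite sgN dotNr oppr_ge0.
  have wu : dot (realmx w) (realmx u) = 0 :> R.
    by apply/eqP; rewrite eq_le cell_le ?Tw //; apply/cellP.
  have /eqP : dot x (- realmx u) = 0.
    apply: ri => // [y /cell_le|]; first by rewrite dotNr oppr_ge0.
    by rewrite dotNr wu oppr0.
  by rewrite dotNr oppr_eq0 => /eqP ->.
by rewrite expr0 scale1r => <-; have /cellP [_] := ex; apply.
Qed.

(** * The stack of a fan as a full subcategory over its cone *)

Section FanProjection.
Variables (s : cone R) (S : set (set 'rV[R]_(rk s))).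
Hypothesis fanS : fan_subdividing S.

(** Since [h1] meets the interior of its cone, some relative interior point of [himg g1] lies in
    [himg g2]. The intersection is a face of [himg g1], so it is all of it, and [g1] factors through
    [g2] as a face. *)
Lemma fan_proj_mono : monomorphism (fan_proj S).
Proof.
move=> r r' f [r1 [g1 [eg1 Sg1]] h1 m1] [r2 [g2 [eg2 Sg2]] h2 m2] /= b.
have bE : cone_comp h1 g1 = cone_comp f (cone_comp h2 g2) := b.
have [_ _ _ iS _] := fanS.
have h12 : face_of (himg g1 `&` himg g2) (himg g1) by apply: iS.
have h21 : face_of (himg g2 `&` himg g1) (himg g2) by apply: iS.
have g12 : himg g1 `<=` himg g1 `&` himg g2.
  have [x [rx /interior_relint /(relint_image (realmx g1)) ri]] := m1.
  apply: (relint_face_sub h12 _ ri) => //; split; first by have [] := ri.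
  exists (x *m realmx f *m realmx h2); first by do 2 apply: hmxP.
  rewrite -!mulmxA -!realmxM; congr (_ *m realmx _).
  by move/(congr1 (@hmx _ _ _)): bE => /= <-.
have [k kE] : exists k, cone_comp k g2 = g1.
  by apply: embedding_factor => // x /g12 [].
have I12 : himg g2 `&` himg g1 = himg g1.
  by rewrite setIC; apply/seteqP; split=> [x []|].
rewrite I12 in h21.
have fk : face_morphism k by apply: (embedding_factor_face eg2); rewrite kE.
have bk : cone_comp h1 k = cone_comp f h2.
  apply: (embedding_cancel eg2).
  transitivity (cone_comp h1 g1).
    by rewrite -kE; apply: (esym (@seqcA (RPC R) _ _ _ _ _ _ _)).
  by rewrite bE; apply: (@seqcA (RPC R)).
unshelve eexists.
  by apply: (@SoArr R (fan_cone_stack S) r r' f (SoOb _ m1) (SoOb _ m2) (FaceHom fk)).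
split; first exact: (@Prop_irrelevance (_ = _ :> cone_hom _ _)).
move=> [k' m' e'] _; apply: so_arr_eq => /=.
have kk' : FaceHom fk = k'.
  apply: face_hom_eq; apply: (embedding_cancel eg2) => /=; rewrite kE.
  exact: m'.
subst k'; congr existT; exact: (@Prop_irrelevance (_ = _ :> cone_hom _ _)).
Qed.

(** To obtain an object of the fan stack, [T] is replaced by its smallest face containing the image
    of an interior point of [t]; the factored map then meets the interior. *)
Lemma fan_proj_image (t : cone R) (h : @rep (RPC R) s t) :
  ess_image (fan_proj S) h <-> exists2 T, S T & himg h `<=` T.
Proof.
rewrite ess_image_rep; split=> [[[r [g [eg Sg]] k mk] <-]|[T ST hT]].
  exists (himg g) => //=; rewrite himg_comp => _ [y ky <-].
  by exists y => //; apply: himg_sub ky.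
have [_ rS fS _ _] := fanS.
have [w wt] := cone_interior_exists t; have := wt.
move=> /interior_relint /(relint_image (realmx h)) riw.
have [|F [FT riF]] := min_face (rS T ST) (w := realmx w *m realmx h).
  by apply: hT; have [] := riw.
have SF : S F by apply: fS ST FT.
have hF : himg h `<=` F by apply: relint_face_sub FT hT riw _; have [] := riF.
have [r [g [eg gF]]] := subcone_embedding (rS F SF) (fan_sub fanS SF).
subst F; have [k kE] := embedding_factor eg hF.
have mk : meets_interior k.
  exists (realmx w); split; first by have [] := (interior_relint _).1 wt.
  apply/interior_relint/(relint_image_inj (embedding_free eg)).
  by rewrite -mulmxA -realmxM; move: riF; rewrite -kE.
by exists (@SoOb _ (fan_cone_stack S) t r (exist _ g (conj eg SF)) k mk).
Qed.

End FanProjection.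
End Fans.

(** * Subdivisions and the stack MY *)

Section Subdivisions.
Context {R : realType}.
Implicit Types X Y Z W : catover (RPC R).

(** Both [p] and the fan projection are fully faithful, so equal essential images make them
    equivalent over [s]. *)
Lemma subdivision_of_cone_mono (s : cone R) W (p : functor W (@rep (RPC R) s)) S :
  monomorphism p -> fan_subdividing S ->
  (forall (t : RPC R) (h : @rep (RPC R) s t),
     ess_image p h <-> exists2 T, S T & himg h `<=` T) ->
  subdivision_of_cone p.
Proof.
move=> mp fS im; exists S; split=> //.
have fr : fibred_in_groupoids (@rep (RPC R) s) by apply: rep_fibred.
have [|E] := @mono_lift _ _ _ _ (fan_proj S) p fr mp.
  by move=> t c; apply/im/(fan_proj_image fS)/ess_image_obj.
exists E; split; last by exists; apply: om_iso E.
apply: (mono_equivalence _ fr (fan_proj_mono fS) mp) => t w.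
by apply/(fan_proj_image fS)/im/ess_image_obj.
Qed.

Lemma subdivision_of_cone_image (s : cone R) W (p : functor W (@rep (RPC R) s)) :
  subdivision_of_cone p -> exists S, fan_subdividing S /\
  forall (t : RPC R) (h : @rep (RPC R) s t),
     ess_image p h <-> exists2 T, S T & himg h `<=` T.
Proof.
move=> [S [fS [E [[G [_ [n]]] [m]]]]]; exists S; split=> // t h.
rewrite -(fan_proj_image fS); split=> [[w wh]|[c ch]].
  exists (G t w); apply: arr_idl (nat_iso_arrV m (G t w)) _.
  exact: arr_idl (arr_fa p (nat_iso_arr n w)) wh.
by exists (E t c); apply: arr_idl (nat_iso_arr m c) ch.
Qed.

Lemma subdivision_mono X Y (F : functor Y X) :
  fibred_in_groupoids X -> monomorphism F ->
  (forall (s : RPC R) (x : X s), exists S, fan_subdividing S /\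
     forall (t : RPC R) (h : hom t s) (z : X t), inhabited (arr h z x) ->
       (ess_image F z <-> exists2 T, S T & himg h `<=` T)) ->
  subdivision F.
Proof.
move=> fX mF im s g; have [S [fS imS]] := im s (g s (idc s)).
apply: (subdivision_of_cone_mono _ fS); first exact: fp_proj2_mono.
move=> t h; rewrite (ess_image_fp_proj2 _ _ _ _ fX); last exact: rep_fibred.
by apply: imS; apply: functor_rep_arr.
Qed.

Lemma subdivision_image X Y (F : functor Y X) (s : RPC R) (x : X s) :
  fibred_in_groupoids X -> subdivision F -> exists S, fan_subdividing S /\
     forall (t : RPC R) (h : hom t s) (z : X t), inhabited (arr h z x) ->
       (ess_image F z <-> exists2 T, S T & himg h `<=` T).
Proof.
move=> fX sF; have [g gx] := yoneda x fX.
have [S [fS im]] := subdivision_of_cone_image (sF s g); exists S; split=> // t h z zx.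
rewrite -im (ess_image_fp_proj2 _ _ _ _ fX); last exact: rep_fibred.
have zg := arr_lift fX (seqc_idl h) (gx t h) zx.
by split; apply: ess_image_iso => //; apply: fibred_sym.
Qed.

(** * Membership in [MY]: covers, pullback, descent and minimality *)

Section Saturation.
Variables (X Y : catover (RPC R)) (F : functor Y X).
Hypotheses (fX : fibred_in_groupoids X) (fY : fibred_in_groupoids Y).
Hypothesis mF : monomorphism F.

Lemma in_MYP (s : RPC R) (x : X s) : in_MY F x <->
  exists S, fan_subdividing S /\
    forall (t : RPC R) (h : hom t s) (z : X t), inhabited (arr h z x) ->
      (exists2 T, S T & himg h `<=` T) -> ess_image F z.
Proof.
split=> [[g [[a _] [S [fS [L [n]]]]]]|[S [fS im]]].
  exists S; split=> // t h z zx /(fan_proj_image fS) /ess_image_rep [c cE]; subst h.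
  exists (L t c); apply: arr_idl (nat_iso_arr n c) _ => /=.
  apply: (arr_lift fX (seqc_idl _) zx).
  apply: arr_idr (functor_rep_arr g _) _; exact: inhabits a.
have [g gx] := yoneda x fX.
exists g; split.
  have [a] := gx s (idc s); exists a; exact: fibred_inv.
exists S; split=> //; have [|L] := mono_lift (H := fcomp g (fan_proj S)) fX mF.
  move=> t c; apply: (im t _ _ (gx t (fan_proj S t c))).
  by apply/(fan_proj_image fS)/ess_image_obj.
by exists L; exists; apply: om_iso L.
Qed.

Lemma in_MY_cover (s : RPC R) (x : X s) (P : set (set 'rV[R]_(rk s))) :
  finite_set P -> (forall T, P T -> rational_polyhedral T) ->
  cset s `<=` \bigcup_(T in P) T ->
  (forall (t : RPC R) (h : hom t s) (z : X t) T, P T -> himg h `<=` T ->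
     inhabited (arr h z x) -> ess_image F z) ->
  in_MY F x.
Proof.
move=> finP rP cP im; have [S [fS SP]] := cover_refinement finP rP cP.
apply/in_MYP; exists S; split=> // t h z zx [A SA hA].
by have [T PT AT] := SP A SA; apply: (im t h z T PT _ zx); apply: subset_trans hA AT.
Qed.

Lemma ess_image_in_MY (s : RPC R) (x : X s) : ess_image F x -> in_MY F x.
Proof.
move=> imx; have [S [fS Ss]] := trivial_fan s; apply/in_MYP; exists S; split=> //.
by move=> t h z zx _; apply: (ess_image_pullback fY fX zx).
Qed.

Lemma in_MY_pullback (s t : RPC R) (f : hom t s) (z : X t) (x : X s) :
  inhabited (arr f z x) -> in_MY F x -> in_MY F z.
Proof.
move=> zx /in_MYP [S [fS im]]; have [finS rS _ _ uS] := fS.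
(* The preimages only have to cover [t]; they need not stay inside [t] or form a fan. *)
pose pb (T : set 'rV[R]_(rk s)) : set 'rV[R]_(rk t) :=
  [set y | T (y *m realmx f)].
apply: (in_MY_cover (P := [set pb T | T in S])).
- exact: finite_image.
- by move=> _ [T /rS rT <-]; apply: rational_polyhedral_preimage.
- move=> y ty; have : cset s (y *m realmx f) by apply: hmxP.
  by rewrite -uS => -[T ST Ty]; exists (pb T) => //; exists T.
move=> t' h z' _ [T ST <-] hT z'z; apply: im (arr_trans z'z zx) _.
by exists T => //= _ [y ty <-]; rewrite realmxM mulmxA; apply: hT; exists y.
Qed.

(** Each cone of [S] is embedded as a cone of its own, carries a fan by membership of the
    restriction of [x], and this fan is pushed forward to [s]; together the pushed cones are a
    finite cover of [s]. *)
Lemma in_MY_descent (s : RPC R) (x : X s) (S : set (set 'rV[R]_(rk s))) :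
  fan_subdividing S ->
  (forall (t : RPC R) (h : hom t s) (z : X t), inhabited (arr h z x) ->
      (exists2 T, S T & himg h `<=` T) -> in_MY F z) ->
  in_MY F x.
Proof.
move=> fS im; have [finS rS _ _ uS] := fS.
have /choice [Q QP] (T : set 'rV[R]_(rk s)) : exists Q : set (set 'rV[R]_(rk s)),
    S T -> [/\ finite_set Q, forall A, Q A -> rational_polyhedral A,
      T `<=` \bigcup_(A in Q) A
    & forall (t : RPC R) (h : hom t s) (z : X t) A, Q A -> himg h `<=` A ->
       inhabited (arr h z x) -> ess_image F z].
  have [ST|] := pselect (S T); last by exists set0.
  have [r [g [eg gT]]] := subcone_embedding (rS T ST) (fan_sub fS ST).
  have [z0 z0x] := proj1 fX r s g x.
  have [|Sr [fSr imr]] := (in_MYP z0).1.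
    by apply: im z0x _; exists T => //; rewrite gT.
  have [finr rr _ _ ur] := fSr.
  exists [set [set y *m realmx g | y in A] | A in Sr] => _; split.
  - exact: finite_image.
  - by move=> _ [A /rr rA <-]; apply: rational_polyhedral_image.
  - rewrite -gT => _ [y ry <-]; move: ry; rewrite -ur => -[A SA Ay].
    by exists [set y *m realmx g | y in A]; [exists A | exists y].
  move=> t h z _ [A SA <-] hA zx.
  have [|k kE] := @embedding_factor R _ _ _ g h eg.
    move=> y /hA [v Av <-]; exists v => //.
    exact: fan_sub fSr SA _ Av.
  apply: (imr t k z (arr_lift fX (esym kE) z0x zx)); exists A => // v kv.
  have : himg h (v *m realmx g) by rewrite -kE himg_comp; exists v.
  by move=> /hA [v' Av' /(row_free_inj (embedding_free eg)) <-].
apply: (in_MY_cover (P := \bigcup_(T in S) Q T)).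
- by apply: bigcup_finite => // T /QP [].
- by move=> A [T /QP [_ rQ _ _] /rQ].
- rewrite -uS => y [T ST Ty]; have [_ _ cQ _] := QP T ST.
  by have [A QA Ay] := cQ y Ty; exists A => //; exists T.
by move=> t h z A [T /QP [_ _ _ iQ] QA]; apply: iQ QA.
Qed.

Lemma MY_fibred : fibred_in_groupoids (MY F).
Proof. by apply: full_sub_fibred => // s t f x y xy; apply: in_MY_pullback xy. Qed.

Lemma MY_incl_mono : monomorphism (MY_incl F).
Proof. exact: full_sub_incl_mono. Qed.

Lemma ess_image_MY_incl (s : RPC R) (x : X s) : ess_image (MY_incl F) x <-> in_MY F x.
Proof.
split=> [[[y my] yx]|mx].
  by apply: (in_MY_pullback _ my); apply: fibred_sym.
by exists (exist _ x mx); exists; apply: ida.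
Qed.

(** Over each cone of the fan given by [S], an object of [Y1] comes from [Y2], where [H] puts it in
    [MY]; descent then puts the object itself in [MY]. *)
Lemma MY_minimal : minimal (MY_incl F).
Proof.
move=> Y1 Y2 F1 S fY1 fY2 sS H.
have [|K] := mono_lift (H := F1) fX MY_incl_mono.
  move=> s y1; apply/ess_image_MY_incl.
  have [Sg [fSg im]] := subdivision_image y1 fY1 sS.
  apply: (in_MY_descent fSg) => t h z zy hT.
  have [z1 z1y] := proj1 fY1 _ _ h y1.
  have [y2 y2z1] := (im t h z1 z1y).2 hT.
  apply/ess_image_MY_incl; exists (H t y2).
  apply: arr_idl (nat_iso_arr (om_iso H) y2) _ => /=.
  apply: arr_idl (arr_fa F1 y2z1) _.
  exact: arr_lift fX (seqc_idl h) zy (arr_fa F1 z1y).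
exists K; split; first exact: mono_lift_unique fX MY_incl_mono.
by move=> K' _; apply: mono_lift_unique fX MY_incl_mono.
Qed.

Definition to_MY : functor Y (MY F).
Proof.
apply: (@Functor (RPC R) Y (MY F)
  (fun s y => exist _ (F s y) (ess_image_in_MY (ess_image_obj F y)))
  (fun s t f x y a => fa F a)).
- by move=> s x; apply: fa_id.
- by move=> *; apply: fa_cmp.
Defined.

Lemma to_MYE : fcomp (MY_incl F) to_MY = F.
Proof.
rewrite /to_MY /fcomp /=; case: F => fo fa i c /=.
by rewrite (Prop_irrelevance (fun s x => _) i) (Prop_irrelevance (fun s t u => _) c).
Qed.

End Saturation.

Lemma subdivision_id Y : fibred_in_groupoids Y -> subdivision (fid Y).
Proof.
move=> fY; apply: subdivision_mono => //.
  by move=> s t f x y b; exists b; split.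
move=> s x; have [S [fS Ss]] := trivial_fan s; exists S; split=> // t h z _.
split=> _; last exact: (ess_image_obj (fid Y)).
by exists (cset s) => //; apply: himg_sub.
Qed.

(** The existence half of minimality, in terms of essential images. *)
Lemma minimal_image X Y Y1 Y2 (F : functor Y X) (F1 : functor Y1 X)
    (S : functor Y2 Y1) :
  fibred_in_groupoids X -> fibred_in_groupoids Y1 -> fibred_in_groupoids Y2 ->
  monomorphism F -> minimal F -> subdivision S ->
  (forall s (y : Y2 s), ess_image F (F1 s (S s y))) ->
  forall s (y : Y1 s), ess_image F (F1 s y).
Proof.
move=> fX f1 f2 mF minF sS im s y.
have [H] := mono_lift (H := fcomp F1 S) fX mF im.
have [K _] := minF _ _ F1 S f1 f2 sS H.
by apply: (ess_image_over K); apply: ess_image_obj.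
Qed.

(* Minimality passes from Y3 to Y' through the common refinement of Y' and Y3,
   which is a subdivision of Y' because Y3 is one of Y0. *)
Lemma minimal_image_common X Y0 Y' Y3 M (F0 : functor Y0 X) (F' : functor Y' X)
    (F3 : functor Y3 X) (F : functor M X) (S' : over_mor F' F0) (S3 : over_mor F3 F0) :
  fibred_in_groupoids X -> fibred_in_groupoids Y0 -> fibred_in_groupoids Y' ->
  fibred_in_groupoids Y3 -> monomorphism F0 -> subdivision S3 ->
  monomorphism F -> minimal F -> over_mor F3 F ->
  forall s (y : Y' s), ess_image F (F' s y).
Proof.
move=> fX f0 f' f3 m0 sS3 mF minF K3.
(* The part of [Y'] in the image of [Y3]. As [F0] is fully faithful, the comparison can be made in
   [Y0] instead of [X], where [S3] is a subdivision. *)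
pose P s (y : Y' s) := ess_image F3 (F' s y).
have fW : fibred_in_groupoids (full_sub P).
  apply: full_sub_fibred => // s t f x y xy; rewrite /P.
  exact: ess_image_pullback f3 fX (arr_fa F' xy).
have P3 s (y : Y' s) : P s y <-> ess_image S3 (S' s y).
  split=> [[y3 y3y]|[y3 y3y]]; exists y3.
    apply: (mono_arr m0); apply: arr_idl (nat_iso_arr (om_iso S3) y3) _.
    exact: arr_idl y3y (nat_iso_arrV (om_iso S') y).
  apply: arr_idl (nat_iso_arrV (om_iso S3) y3) _.
  exact: arr_idl (arr_fa F0 y3y) (nat_iso_arr (om_iso S') y).
apply: (minimal_image (S := full_sub_incl P)) => //.
  apply: subdivision_mono => //; first exact: full_sub_incl_mono.
  move=> s y; have [Sg [fSg im]] := subdivision_image (S' s y) f0 sS3.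
  exists Sg; split=> // t h z zy; rewrite -(im t h _ (arr_fa S' zy)) -P3.
  split=> [[[w Pw] /= wz]|Pz]; last by exists (exist _ z Pz); exists; apply: ida.
  rewrite /P in Pw *; apply: ess_image_iso Pw => //.
  exact: arr_fa (fibred_sym f' wz).
move=> s [y Py] /=; exact: (ess_image_over K3 Py).
Qed.

End Subdivisions.

(** * Cone stacks over a cone *)

Section Rays.
Context {R : realType}.

Lemma int_right_inverse m n (A : 'M[int]_(m, n)) :
  injective (fun v : 'rV[int]_m => v *m A) ->
  exists (P : 'M[int]_(n, m)) (d : int), 0 < d /\ A *m P = d%:M.
Proof.
move=> injA; pose Q : 'M[rat]_(m, n) := map_mx intr A.
have : row_free Q.
  rewrite -(row_free_map (ratr : {rmorphism rat -> R})).
  have -> : map_mx ratr Q = realmx A :> 'M[R]_(m, n).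
    by apply/matrixP => i j; rewrite !mxE ratr_int.
  exact: row_free_realmx.
move=> /row_freeP [B QB].
(* The product of all denominators of the rational right inverse clears them at once. *)
pose d : int := \prod_(k : 'I_n * 'I_m) denq (B k.1 k.2).
exists (\matrix_(i, j) (numq (B i j) * \prod_(k | k != (i, j)) denq (B k.1 k.2))), d.
split; first by apply: prodr_gt0 => k _; apply: denq_gt0.
set P := \matrix_(i, j) _.
have PB : map_mx intr P = d%:~R *: B.
  apply/matrixP => i j; rewrite !mxE.
  have -> : d = denq (B i j) * \prod_(k | k != (i, j)) denq (B k.1 k.2).
    by rewrite /d (bigD1 (i, j)).
  by rewrite !intrM numqE [RHS]mulrC mulrA.
apply/matrixP => i j; apply: (@intr_inj rat).
have : map_mx intr (A *m P) = d%:~R *: 1%:M :> 'M[rat]_m.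
  by rewrite map_mxM PB -scalemxAr -QB.
move=> /matrixP /(_ i j); rewrite [LHS]mxE => ->.
by rewrite !mxE; case: (i == j); rewrite ?mulr1n ?mulr0n ?mulr1 ?mulr0.
Qed.

Lemma interior_unscale (t : cone R) (p : 'rV[R]_(rk t)) c :
  0 <= c -> interior (cset t) (c *: p) -> interior (cset t) p.
Proof.
move=> c0; have [us [-> us0]] := cone_hrep t; move=> cp.
apply: interior_hcone => u uu.
have := interior_dot_gt0 cp (fun x hx => hx u uu) (us0 u uu).
(* For [c = 0] the strict inequality would read [0 < 0], so there is no such [u]. *)
by rewrite dotZl; move: c0; rewrite le_eqVlt => /orP [/eqP <-|c0];
  rewrite ?mul0r ?ltxx // pmulr_rgt0.
Qed.

Definition ray_set : set 'rV[R]_1 := [set x | 0 <= x 0 0].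

Lemma ray_polyhedral : rational_polyhedral ray_set.
Proof.
apply/rational_polyhedralP; exists [:: 1%:M]; apply/seteqP; split=> x.
  by move=> x0 u; rewrite inE => /eqP ->; rewrite realmx1 /dot mulmx1.
by move=> /(_ _ (mem_head _ _)); rewrite realmx1 /dot mulmx1.
Qed.

Lemma ray_strongly_convex x : ray_set x -> ray_set (- x) -> x = 0.
Proof.
rewrite /ray_set /= mxE oppr_ge0 => x0 x0'; apply/rowP => j.
by rewrite ord1 mxE; apply/eqP; rewrite eq_le x0 x0'.
Qed.

Lemma ray_full v : exists x y, ray_set x /\ ray_set y /\ v = x - y.
Proof.
exists (Num.max (v 0 0) 0)%:M, (Num.max (- v 0 0) 0)%:M; rewrite /ray_set /=.
rewrite !mxE eqxx !mulr1n !le_max lexx !orbT; do 2 split=> //.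
apply/rowP => j; rewrite ord1 !mxE eqxx !mulr1n.
have [v0|v0] := leP 0 (v 0 0).
  by rewrite max_r ?subr0 // oppr_le0.
by rewrite max_l ?sub0r ?opprK // oppr_ge0 ltW.
Qed.

Definition ray : cone R := Cone ray_polyhedral ray_strongly_convex ray_full.

Lemma ray_homP (t : cone R) (q : 'rV[int]_(rk t)) : cset t (realmx q) ->
  forall x, cset ray x -> cset t (x *m realmx q).
Proof.
move=> tq x x0; rewrite [x]mx11_scalar mul_scalar_mx.
by apply: rational_polyhedralZ tq; [apply: cone_polyhedral | apply: x0].
Qed.

Definition ray_hom (t : cone R) (q : 'rV[int]_(rk t)) (tq : cset t (realmx q)) :
  cone_hom ray t := ConeHom (ray_homP tq).

Lemma ray_hom_interior (t : cone R) (h : cone_hom ray t) :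
  meets_interior h <-> interior (cset t) (realmx h).
Proof.
split=> [[x [x0]]|th].
  by rewrite [x]mx11_scalar mul_scalar_mx; apply: interior_unscale.
by exists 1%:M; rewrite mul1mx; split=> //=; rewrite /ray_set /= mxE.
Qed.

Lemma meets_interior_id (t : cone R) : meets_interior (cone_id t).
Proof.
have [w wt] := cone_interior_exists t; exists (realmx w).
by rewrite realmx1 mulmx1; split=> //; have [] := (interior_relint _).1 wt.
Qed.

End Rays.

(** * The charts of a cone stack and the fan that they form *)

Section ConeStacks.
Context {R : realType}.
Variables (s : cone R) (C : catover (RPCf R)).
Variable psi : functor (stack_of C) (@rep (RPC R) s).
Hypotheses (fC : finite_cone_stack C) (mono_psi : monomorphism psi).
Hypothesis sieve_psi : forall (t t' : RPC R) (k : hom t' t) (h : @rep (RPC R) s t),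
  ess_image psi h -> ess_image psi (seqc k h : @rep (RPC R) s t').
Variable Sg : set (set 'rV[R]_(rk s)).
Hypothesis fSg : fan_subdividing Sg.
Hypothesis Sg_psi : forall (t : RPC R) (h : @rep (RPC R) s t),
  (exists2 T, Sg T & himg h `<=` T) -> ess_image psi h.

(** The value of [psi] at the tautological object over [c]; by [psiE] the charts determine [psi] on
    all objects. *)
Definition chart (t : cone R) (c : C t) : cone_hom t s :=
  psi t (SoOb c (meets_interior_id t)).

Lemma psiE (r t : cone R) (c : C t) (h : cone_hom r t) (m : meets_interior h) :
  psi r (SoOb c m) = cone_comp h (chart c).
Proof.
have a : so_arr h (SoOb c m) (SoOb c (meets_interior_id t)).
  by exists (face_id t); first exact: (@ida (RPCf R) C).
have psi_a := fa psi (a : @arr _ (stack_of C) _ _ _ _ _).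
exact: (@rep_arr_eq (RPC R) s r t h _ _ (inhabits psi_a)).
Qed.

Lemma chart_arr (t t' : cone R) (k : face_hom t t') (c : C t) (c' : C t') :
  inhabited (@arr (RPCf R) C _ _ k c c') -> chart c = cone_comp k (chart c').
Proof.
move=> [a].
have b : so_arr k (SoOb c (meets_interior_id t)) (SoOb c' (meets_interior_id t')).
  exists k => //=; apply: etrans (esym (@seqc_idl (RPC R) _ _ _)) _.
  exact: (@seqc_idr (RPC R)).
have psi_b := fa psi (b : @arr _ (stack_of C) _ _ _ _ _).
exact: (@rep_arr_eq (RPC R) s t t' k _ _ (inhabits psi_b)).
Qed.

Lemma himg_chart_arr (t t' : cone R) (k : face_hom t t') (c : C t) (c' : C t') :
  inhabited (@arr (RPCf R) C _ _ k c c') -> himg (chart c) `<=` himg (chart c').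
Proof.
move=> /chart_arr ->; rewrite himg_comp => _ [y ky <-]; exists y => //.
exact: himg_sub ky.
Qed.

(** Interior lattice points are objects of the stack over the ray. Equality of their images in [s]
    is an arrow over the identity of the ray, which full faithfulness lifts; the lift contains the
    face morphism [k]. *)
Lemma chart_point_arr (t t' : cone R) (c : C t) (c' : C t') q q' :
  interior (cset t) (realmx q) -> interior (cset t') (realmx q') ->
  q *m chart c = q' *m chart c' ->
  exists k : face_hom t t', inhabited (@arr (RPCf R) C _ _ k c c') /\ q *m k = q'.
Proof.
move=> tq tq' E.
have tq0 : cset t (realmx q) by have [] := (interior_relint _).1 tq.
have tq0' : cset t' (realmx q') by have [] := (interior_relint _).1 tq'.
have m : meets_interior (ray_hom tq0) by apply/ray_hom_interior.
have m' : meets_interior (ray_hom tq0') by apply/ray_hom_interior.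
have b : psi _ (SoOb c m) = cone_comp (cone_id ray) (psi _ (SoOb c' m')).
  rewrite !psiE; apply: etrans (@seqc_idl (RPC R) _ _ _).
  exact: cone_hom_eq.
have [[k a e] _] := @mono_psi ray ray (cone_id ray) (SoOb c m) (SoOb c' m') b.
exists k; split; first by exists.
by move/(congr1 (@hmx _ _ _)): e => /=; rewrite mul1mx.
Qed.

Lemma himg_chart_point (t t' : cone R) (c : C t) (c' : C t') q q' :
  interior (cset t) (realmx q) -> interior (cset t') (realmx q') ->
  q *m chart c = q' *m chart c' -> himg (chart c) = himg (chart c').
Proof.
move=> tq tq' E; apply/seteqP; split.
  by have [k [a _]] := chart_point_arr tq tq' E; apply: himg_chart_arr a.
by have [k [a _]] := chart_point_arr tq' tq (esym E); apply: himg_chart_arr a.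
Qed.

(* If [v] were a nonzero kernel vector and [p] an interior point, the points
   [n p] and [n p + v] of [s] would coincide for all large [n], and the arrows
   of [C] relating them would be infinitely many automorphisms of [c]. *)
Lemma chart_inj (t : cone R) (c : C t) :
  injective (fun v : 'rV[int]_(rk t) => v *m chart c).
Proof.
suff ker (v : 'rV[int]_(rk t)) : v *m chart c = 0 -> v = 0.
  by move=> v w /= vw; apply/eqP; rewrite -subr_eq0; apply/eqP/ker;
    rewrite mulmxBl vw subrr.
move=> v0; apply: contrapT => vn0.
have [p tp] := cone_interior_exists t.
have [N NP] := interior_archi (realmx v) tp.
(* At least [N], to keep [a n *: p + v] interior, and shifted by one to be positive. *)
pose a n : int := (N + n).+1%:Z.
have aE n q : realmx (a n *: q) = (N + n).+1%:R *: realmx q :> 'rV[R]_(rk t).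
  by rewrite realmxZ.
have ex n : exists f : {f : @hom (RPCf R) t t & @arr (RPCf R) C _ _ f c c},
    (a n *: p) *m (projT1 f : face_hom t t) = a n *: p + v.
  have [|||k [[b] kE]] := @chart_point_arr t t c c (a n *: p) (a n *: p + v).
  - by rewrite aE; apply: interior_scale.
  - by rewrite realmxD aE; apply: NP; rewrite ler_nat leqW ?leq_addr.
  - by rewrite mulmxDl v0 addr0.
  by exists (existT _ k b).
pose f n := sval (cid (ex n)).
have fP n : (a n *: p) *m (projT1 (f n) : face_hom t t) = a n *: p + v.
  exact: svalP (cid (ex n)).
have xE n : a n *: (p *m (projT1 (f n) : face_hom t t) - p) = v.
  by rewrite scalerBr scalemxAl fP addrAC subrr add0r.
have injf : injective f.
  move=> n n' E; have := xE n; have := xE n'; rewrite -E.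
  set x := _ - p => <- /eqP; rewrite -subr_eq0 -scalerBl => /eqP x0.
  have aa : a n = a n'.
    apply/eqP; rewrite -subr_eq0; apply/negP => /negP an.
    apply: vn0; rewrite -(xE n) -/x; suff -> : x = 0 by rewrite scaler0.
    apply/rowP => j; move/rowP: x0 => /(_ j); rewrite !mxE => /eqP.
    by rewrite mulf_eq0 (negPf an) => /eqP.
  by case: aa => /addnI.
have [_ [_ finC]] := fC.
have := @finite_preimage _ _ _ f (in2W injf) (finC t t c c).
rewrite preimage_setT; exact: infinite_nat.
Qed.

Lemma chart_free (t : cone R) (c : C t) : row_free (realmx (chart c) : 'M[R]_(_, _)).
Proof. exact/row_free_realmx/chart_inj. Qed.

Lemma fan_point (w : 'rV[int]_(rk s)) : cset s (realmx w) ->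
  exists (t : cone R) (c : C t) q, interior (cset t) (realmx q) /\ q *m chart c = w.
Proof.
move=> sw; have [_ rS _ _ uS] := fSg.
have [T ST Tw] : (\bigcup_(T in Sg) T) (realmx w) by rewrite uS.
have [|[t c h m] /= hE] := (ess_image_rep psi (ray_hom sw : @rep (RPC R) s ray)).1.
  apply: Sg_psi; exists T => // _ [x x0 <-] /=.
  rewrite [x]mx11_scalar mul_scalar_mx; apply: rational_polyhedralZ => //.
  exact: rS.
exists t, c, (h : 'M_(_, _)); split; first exact/ray_hom_interior.
by move: hE; rewrite psiE => /(congr1 (@hmx _ _ _)).
Qed.

(** The lattice point [w] also comes from an integral interior point [q'] of some chart. A multiple
    [d] makes [v] integral, an arrow then sends [d *: q'] to [d *: v], and dividing by [d] shows
    that [v] is the image of [q']. *)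
Lemma chart_interior_int (t : cone R) (c : C t) (v : 'rV[R]_(rk t)) w :
  interior (cset t) v -> v *m realmx (chart c) = realmx w ->
  exists z, v = realmx z.
Proof.
move=> tv vw; have sw : cset s (realmx w).
  by rewrite -vw; apply: hmxP; have [] := (interior_relint _).1 tv.
have [t' [c' [q' [tq' qw]]]] := fan_point sw.
have [P [d [d0 PE]]] := @int_right_inverse R _ _ _ (@chart_inj t c).
have d0R : 0 < d%:~R :> R by rewrite ltr0z.
have dv : realmx (w *m P) = d%:~R *: v.
  rewrite realmxM -vw -mulmxA -realmxM PE -mul_mx_scalar; congr (_ *m _).
  by apply/matrixP => i j; rewrite !mxE; case: (i == j); rewrite ?mulr1n ?mulr0n.
have [|||k [_ kE]] := @chart_point_arr t' t c' c (d *: q') (w *m P).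
- by rewrite realmxZ; apply: interior_scale.
- by rewrite dv; apply: interior_scale.
- apply: (@realmx_inj R); rewrite [LHS]realmxM [RHS]realmxM dv realmxZ -!scalemxAl vw.
  by rewrite -realmxM qw.
exists (q' *m k); apply: (scalerI (lt0r_neq0 d0R)).
by rewrite -dv -kE -scalemxAl realmxZ.
Qed.

Lemma chart_embedding (t : cone R) (c : C t) : lattice_embedding (chart c).
Proof.
split=> [|w [v vw]]; first exact: chart_inj.
have [p tp] := cone_interior_exists t.
(* Adding a multiple of the lattice point [p] moves [v] into the interior without changing whether
   it is integral. *)
have [N NP] := interior_archi v tp.
have [|z zE] := @chart_interior_int t c _ (N%:Z *: (p *m chart c) + w) (NP _ (lexx _)).
  by rewrite mulmxDl vw -scalemxAl realmxD realmxZ realmxM.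
exists (z - N%:Z *: p); apply: (@realmx_inj R).
rewrite realmxM realmxD -zE realmxN realmxZ -vw; congr (_ *m _).
by rewrite addrAC subrr add0r.
Qed.

(** Pulling [c] back to the smallest face containing [v] makes [v] an interior point of a chart. *)
Lemma chart_face_point (t : cone R) (c : C t) (v : 'rV[int]_(rk t)) :
  cset t (realmx v) -> exists (r : cone R) (d : C r) q,
  [/\ interior (cset r) (realmx q), q *m chart d = v *m chart c &
      face_of (himg (chart d)) (himg (chart c))].
Proof.
move=> tv; have [F [Ft ri]] := min_face (cone_polyhedral t) tv.
have [r [k kF]] := face_embedding Ft; subst F.
have [[pC _] _] := fC; have [d dc] := pC r t k c.
have [q qk] : exists q, q *m k = v.
  by have [[x _ xv] _] := ri; apply: (proj2 (proj1 (fhomP k))); exists x.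
exists r, d, q; rewrite (chart_arr dc); split.
- apply/interior_relint/(relint_image_inj (embedding_free (proj1 (fhomP k)))).
  by rewrite -realmxM qk.
- by rewrite /= mulmxA qk.
- by rewrite himg_comp; apply: face_of_image Ft; apply: chart_free.
Qed.

(** Take a lattice point in the relative interior of the intersection. The smallest faces of the two
    charts containing it are charts with a common interior point, so they have the same image, and
    this image is the intersection. *)
Lemma chart_face_inter (t t' : cone R) (c : C t) (c' : C t') :
  face_of (himg (chart c) `&` himg (chart c')) (himg (chart c)).
Proof.
have [w wI] : exists w : 'rV[int]_(rk s),
    relint (himg (chart c) `&` himg (chart c')) (realmx w).
  by apply/relint_exists/rational_polyhedralI; apply: himg_polyhedral.
have [[wc wc'] _] := wI.
have lift (t0 : cone R) (c0 : C t0) : himg (chart c0) (realmx w) ->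
    exists2 v, cset t0 (realmx v) & v *m chart c0 = w.
  move=> [x tx xw]; have [v vw] := (proj2 (chart_embedding c0)) w (ex_intro _ x xw).
  exists v => //; suff <- : x = realmx v by [].
  by apply: (row_free_inj (chart_free c0)); rewrite xw -realmxM vw.
have [v tv vw] := lift _ _ wc; have [v' tv' vw'] := lift _ _ wc'.
have [r [d [q [rq qd fd]]]] := chart_face_point c tv.
have [r' [d' [q' [rq' qd' fd']]]] := chart_face_point c' tv'.
have dd' : himg (chart d) = himg (chart d').
  by apply: himg_chart_point rq rq' _; rewrite qd qd' vw vw'.
suff -> : himg (chart c) `&` himg (chart c') = himg (chart d) by [].
apply/seteqP; split.
  apply: relint_face_sub fd _ wI _; first by move=> x [].
  exists (realmx q); first by have [] := (interior_relint _).1 rq.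
  by rewrite -realmxM qd vw.
move=> x dx; split; first exact: face_of_sub fd _ dx.
by rewrite dd' in dx; apply: face_of_sub fd' _ dx.
Qed.

Lemma cone_stack_fan : exists S, fan_subdividing S /\
  forall (t : RPC R) (h : @rep (RPC R) s t),
    ess_image psi h <-> exists2 T, S T & himg h `<=` T.
Proof.
pose P := [set A | exists t (c : C t), A = himg (chart c)].
exists [set F | exists2 T, P T & face_of F T]; split.
  apply: fan_of_faces.
  - have [_ [[D [finD DP]] _]] := fC.
    apply: (@sub_finite_set _ _ [set himg (chart (projT2 d)) | d in D]); last first.
      exact: finite_image.
    (* Isomorphic objects have arrows both ways, hence charts with the same image. *)
    move=> _ [t [c ->]]; have [d [Dd [f [g [a [b _]]]]]] := DP t c.
    exists d => //; apply/seteqP; split.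
      exact: himg_chart_arr (inhabits b).
    exact: himg_chart_arr (inhabits a).
  - by move=> _ [t [c ->]]; apply: himg_polyhedral.
  - by move=> _ _ [t [c ->]] [t' [c' ->]]; apply: chart_face_inter.
  apply/seteqP; split=> [x [_ [t [c ->]]] /himg_sub //|x sx].
  have [_ rS _ _ uS] := fSg; move: sx; rewrite -uS => -[T ST Tx].
  have [r [g [eg gT]]] := subcone_embedding (rS T ST) (fan_sub fSg ST).
  have [|[t c h m] hE] := (ess_image_rep psi (g : @rep (RPC R) s r)).1.
    by apply: Sg_psi; exists T => //; rewrite gT.
  exists (himg (chart c)); first by exists t, c.
  move: Tx; rewrite -gT -hE psiE himg_comp => -[y hy <-]; exists y => //.
  exact: himg_sub hy.
move=> t h; split=> [/ess_image_rep [[r c k m] <-]|[F [_ [r [c ->]] Fc] hF]].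
  exists (himg (chart c)); first exists (himg (chart c)).
  - by exists r, c.
  - exact: face_of_refl.
  by rewrite psiE himg_comp => _ [y ky <-]; exists y => //; apply: himg_sub ky.
have [|k <-] := @embedding_factor R _ _ _ (chart c) h (chart_embedding c).
  by apply: subset_trans hF (face_of_sub Fc).
by apply: (@sieve_psi r t k (chart c)); apply: ess_image_obj.
Qed.

End ConeStacks.

Section Representable.
Context {R : realType}.
Variables (X Y : catover (RPC R)) (F : functor Y X).
Hypotheses (fX : fibred_in_groupoids X) (fY : fibred_in_groupoids Y).
Hypotheses (mF : monomorphism F) (rF : representable_by_finite_cone_stacks F).

Lemma to_MY_mono : monomorphism (to_MY fX fY mF).
Proof. by apply: (mono_of_comp (@MY_incl_mono R X Y F)); rewrite to_MYE. Qed.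

(** The fan [Sg] from membership in [MY] only guarantees that the charts cover [s]; the fan
    describing [Y] over [s] is that of the charts of the pulled-back cone stack. *)
Lemma to_MY_subdivision : subdivision (to_MY fX fY mF).
Proof.
apply: subdivision_mono; [exact: MY_fibred | exact: to_MY_mono |].
move=> s [x mx]; have [Sg [fSg im]] := (in_MYP fX mF x).1 mx.
have [g gx] := yoneda x fX; have [C [finC [E eE]]] := rF g.
pose psi := fcomp (fp_proj2 F g) E.
have psiP (t : RPC R) (h : @rep (RPC R) s t) : ess_image psi h <-> ess_image F (g t h).
  rewrite -(ess_image_fp_proj2 F g) //; last exact: rep_fibred.
  split=> [[c ch]|[w wh]]; first by exists (E t c).
  have [G [_ [n]]] := eE; exists (G t w).
  exact: arr_idl (arr_fa (fp_proj2 F g) (nat_iso_arr n w)) wh.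
have mpsi : monomorphism psi.
  by apply: mono_comp (equivalence_mono eE) _; apply: fp_proj2_mono.
have gP (t : RPC R) (h : @rep (RPC R) s t) z : inhabited (arr h z x) ->
    ess_image F (g t h) <-> ess_image F z.
  move=> zx; have zg := arr_lift fX (seqc_idl h) (gx t h) zx.
  by split; apply: ess_image_iso => //; apply: fibred_sym.
have sieve (t t' : RPC R) (k : hom t' t) (h : @rep (RPC R) s t) :
    ess_image psi h -> ess_image psi (seqc k h : @rep (RPC R) s t').
  move=> /psiP; rewrite psiP; apply: ess_image_pullback => //.
  by exists; apply: (fa g); apply: rep_arr.
have Sg_psi (t : RPC R) (h : @rep (RPC R) s t) :
    (exists2 T, Sg T & himg h `<=` T) -> ess_image psi h.
  by move=> hT; apply/psiP; apply: im (gx t h) hT.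
have [S [fS SP]] := cone_stack_fan finC mpsi sieve fSg Sg_psi.
exists S; split=> // t h [z mz] zx; rewrite -SP psiP (gP t h z zx).
by split=> -[y yz]; exists y.
Qed.

End Representable.

(** * Birational classes *)

Section Birational.
Context {R : realType}.
Variables (X Z : catover (RPC R)) (pi : functor X Z) (G : group_object pi).
Hypothesis fX : fibred_in_groupoids X.

Lemma partial_generalized Y (F : functor Y X) :
  partial_compactification G F -> generalized_partial_compactification G F.
Proof.
move=> pF; have [fY mF _ _] := pF; split=> //; exists Y, (fid Y).
by rewrite fcomp_fid; split=> //; apply: subdivision_id.
Qed.

Definition to_MY_over Y (F : functor Y X) (fY : fibred_in_groupoids Y)
    (mF : monomorphism F) : over_mor F (MY_incl F).
Proof.
exists (to_MY fX fY mF); rewrite to_MYE.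
exact: nat_iso_id.
Defined.

Lemma MY_generalized Y (F : functor Y X) :
  partial_compactification G F -> generalized_partial_compactification G (MY_incl F).
Proof.
move=> pF; have [fY mF rF _] := pF; split.
- exact: MY_fibred.
- exact: MY_incl_mono.
- exists Y, (to_MY fX fY mF); rewrite to_MYE; split=> //.
  exact: to_MY_subdivision.
Qed.

(** [Y] itself is the common subdivision, through [S] and [to_MY]. *)
Lemma birational_MY Y0 Y (F0 : functor Y0 X) (F : functor Y X) (S : over_mor F F0) :
  partial_compactification G F -> subdivision S ->
  birationally_equivalent G F0 (MY_incl F).
Proof.
move=> pF sS; have [fY mF rF _] := pF.
exists Y, F, S, (to_MY_over fY mF); split=> //; first exact: partial_generalized.
exact: to_MY_subdivision.
Qed.

(** Minimality through common refinements gives [Y] in the image of [M'] and [Y3] in that of [MY].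
    The subdivisions from [Y] to [MY] and from [Y3] to [M'] then give both inclusions between [MY]
    and [M']. *)
Lemma birational_minimal_unique Y0 Y (F0 : functor Y0 X) (F : functor Y X)
    (S : over_mor F F0) M' (F' : functor M' X) :
  generalized_partial_compactification G F0 -> partial_compactification G F ->
  subdivision S -> generalized_partial_compactification G F' ->
  birationally_equivalent G F0 F' -> minimal F' -> isomorphic_over F' (MY_incl F).
Proof.
move=> [f0 m0 _] pF sS [f' m' _] [Y3 [F3 [S1 [S2 [[f3 m3 _] sS1 sS2]]]]] minF'.
have [fY mF rF _] := pF.
have FF' s (y : Y s) : ess_image F' (F s y).
  exact: (minimal_image_common S fX f0 fY f3 m0 sS1 m' minF' S2).
have F3M s (y : Y3 s) : ess_image (MY_incl F) (F3 s y).
  apply: (minimal_image_common S1 fX f0 f3 fY m0 sS _ _ (to_MY_over fY mF)).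
    exact: MY_incl_mono.
  exact: MY_minimal.
have MF' s (y : MY F s) : ess_image F' (MY_incl F s y).
  apply: (minimal_image fX _ fY m' minF' (to_MY_subdivision fX fY mF rF)) => //.
  exact: MY_fibred.
have F'M s (y : M' s) : ess_image (MY_incl F) (F' s y).
  apply: (minimal_image fX f' f3 _ _ sS2) => [||t y3].
  - exact: MY_incl_mono.
  - exact: MY_minimal.
  exact: ess_image_iso fX (nat_iso_arr (om_iso S2) y3) (F3M t y3).
have [K] := mono_lift fX (@MY_incl_mono R X Y F) F'M.
by exists K; apply: mono_equivalence fX m' (@MY_incl_mono R X Y F) MF'.
Qed.

End Birational.

Theorem theorem4p11 (R : realType) (X Z : catover (RPC R))
    (hX : fibred_in_groupoids X) (hZ : fibred_in_groupoids Z)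
    (pi : functor X Z) (G : group_object pi) (hG : split_semiabelian G) :
  (forall K : forall Y : catover (RPC R), functor Y X -> Prop,
     birational_class G K ->
     exists (M : catover (RPC R)) (F : functor M X),
       K M F /\ minimal F /\
       forall (M' : catover (RPC R)) (F' : functor M' X),
         K M' F' -> minimal F' -> isomorphic_over F' F)
  /\
  (forall (Y : catover (RPC R)) (F : functor Y X),
     partial_compactification G F ->
     generalized_partial_compactification G (MY_incl F) /\
     birationally_equivalent G F (MY_incl F) /\
     minimal (MY_incl F)).
Proof.
split=> [K [Y0 [F0 [gF0 KP]]]|Y F pF]; last first.
  have [fY mF _ _] := pF; split; first exact: MY_generalized.
  split; last exact: MY_minimal.
  by apply: (birational_MY hX (S := over_id F) pF); apply: subdivision_id.
(* The base point of the class need not be a partial compactification, so the minimal element is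
   built from one that subdivides it. *)
have [_ _ [Y [S [sS pF]]]] := gF0; have [fY mF _ _] := pF.
pose S0 : over_mor (fcomp F0 S) F0 := OverMor (nat_iso_id (fcomp F0 S)).
exists (MY (fcomp F0 S)), (MY_incl (fcomp F0 S)); split.
  by apply/KP; split; [apply: MY_generalized | apply: (birational_MY hX (S := S0) pF)].
split; first exact: MY_minimal.
move=> M' F' /KP [gF' bF'] minF'.
exact: (birational_minimal_unique hX (S := S0) gF0 pF sS gF' bF' minF').
Qed.
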